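(* Let $\mathcal{L}$ be the set consisting of the following five-dimensional complex algebras, each with basis $e_1,\dots,e_5$ and all unlisted products of basis elements equal to zero: - $\mathbb{C}^5$ (zero multiplication); - $\mathfrak{H}_{01}$: $e_1e_1=e_5$; - $\mathfrak{H}_{02}$: $e_1e_2=-e_5,\ e_2e_1=e_5,\ e_2e_2=e_5$; - $\mathfrak{H}_{03}^{\lambda}$: $e_1e_2=e_5,\ e_2e_1=\lambda e_5$; - $\mathfrak{H}_{04}$: $e_1e_1=e_5,\ e_2e_3=-e_5,\ e_3e_2=e_5,\ e_3e_3=e_5$; - $\mathfrak{H}_{05}^{\lambda}$: $e_1e_1=e_5,\ e_2e_3=e_5,\ e_3e_2=\lambda e_5$; - $\mathfrak{H}_{06}$: $e_1e_2=e_5,\ e_2e_3=e_5$; - $\mathfrak{H}_{07}$: $e_1e_3=e_5,\ e_2e_2=-e_5,\ e_2e_3=-e_5,\ e_3e_1=e_5,\ e_3e_2=e_5$; - $\mathfrak{H}_{08}$: $e_1e_4=-e_5,\ e_2e_3=e_5,\ e_2e_4=e_5,\ e_3e_2=-e_5,\ e_3e_3=-e_5,\ e_4e_1=e_5,\ e_4e_2=e_5$; - $\mathfrak{H}_{09}^{\lambda}$ ($\lambda\ne-1,0$): $e_1e_3=e_5,\ e_2e_4=e_5,\ e_3e_1=\lambda e_5,\ e_3e_2=e_5,\ e_4e_2=\lambda e_5$; - $\mathfrak{H}_{10}$: $e_1e_1=e_5,\ e_2e_3=e_5,\ e_3e_4=e_5$; - $\mathfrak{H}_{11}$: $e_1e_1=e_5,\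 e_2e_4=e_5,\ e_3e_3=-e_5,\ e_3e_4=-e_5,\ e_4e_2=e_5,\ e_4e_3=e_5$; - $\mathfrak{H}_{12}$: $e_1e_2=-e_5,\ e_2e_1=e_5,\ e_2e_2=e_5,\ e_3e_4=-e_5,\ e_4e_3=e_5,\ e_4e_4=e_5$; - $\mathfrak{H}_{13}^{\lambda;\mu}$: $e_1e_2=e_5,\ e_2e_1=\mu e_5,\ e_3e_4=e_5,\ e_4e_3=\lambda e_5$; - $\mathfrak{H}_{14}^{\lambda}$: $e_1e_2=e_5,\ e_2e_1=\lambda e_5,\ e_3e_4=-e_5,\ e_4e_3=e_5,\ e_4e_4=e_5$; - $\mathfrak{H}_{15}$: $e_1e_2=e_5,\ e_2e_3=e_5,\ e_3e_4=e_5$. All parameters $\lambda,\mu$ lie in $\mathbb{C}_{|\cdot|\le 1}$, and for $\mathfrak{H}_{13}^{\lambda;\mu}$ also $\lambda-\mu\in\mathbb{C}_{\ge0}$. (These are, up to isomorphism, exactly the five-dimensional complex noncommutative Heisenberg algebras, pairwise non-isomorphic.) Let $\Gamma$ be the directed graph on $\mathcal{L}$ with the following edges: - $\mathfrak{H}_{02}\to\mathfrak{H}_{01}$, $\mathfrak{H}_{02}\to\mathfrak{H}_{03}^{-1}$; - $\mathfrak{H}_{03}^{\lambda}\to\mathfrak{H}_{01}$ for $\lambda\ne-1$; - $\mathfrak{H}_{03}^{-1}\to\mathbb{C}^5$, $\mathfrak{H}_{01}\to\mathbb{C}^5$; - $\mathfrak{H}_{04}\to\mathfrak{H}_{05}^{-1}$,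 $\mathfrak{H}_{04}\to\mathfrak{H}_{06}$; - $\mathfrak{H}_{05}^{\lambda}\to\mathfrak{H}_{06}$ for $\lambda\ne\pm1$; - $\mathfrak{H}_{05}^{1}\to\mathfrak{H}_{03}^{1}$; - $\mathfrak{H}_{05}^{-1}\to\mathfrak{H}_{02}$; - $\mathfrak{H}_{06}\to\mathfrak{H}_{02}$, and $\mathfrak{H}_{06}\to\mathfrak{H}_{03}^{\lambda}$ for every $\lambda$; - $\mathfrak{H}_{07}\to\mathfrak{H}_{05}^{1}$, $\mathfrak{H}_{07}\to\mathfrak{H}_{06}$; - $\mathfrak{H}_{08}\to\mathfrak{H}_{10}$, $\mathfrak{H}_{08}\to\mathfrak{H}_{12}$; - $\mathfrak{H}_{09}^{\lambda}\to\mathfrak{H}_{10}$ for $\lambda\ne1$, and $\mathfrak{H}_{09}^{\lambda}\to\mathfrak{H}_{13}^{\lambda;\lambda}$ for every admissible $\lambda$; - $\mathfrak{H}_{09}^{1}\to\mathfrak{H}_{07}$; - $\mathfrak{H}_{10}\to\mathfrak{H}_{04}$, $\mathfrak{H}_{10}\to\mathfrak{H}_{07}$, and $\mathfrak{H}_{10}\to\mathfrak{H}_{05}^{\lambda}$ for every $\lambda$; - $\mathfrak{H}_{11}\to\mathfrak{H}_{09}^{1}$, $\mathfrak{H}_{11}\to\mathfrak{H}_{10}$; - $\mathfrak{H}_{12}\to\mathfrak{H}_{04}$, $\mathfrak{H}_{12}\to\mathfrak{H}_{14}^{-1}$; - $\mathfrak{H}_{13}^{\lambda;-1}\to\mathfrak{H}_{04}$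 for $\lambda\ne-1$; - $\mathfrak{H}_{13}^{\lambda;\lambda}\to\mathfrak{H}_{05}^{\lambda}$ for $\lambda\ne-1$; - $\mathfrak{H}_{13}^{\lambda;\mu}\to\mathfrak{H}_{10}$ for $\lambda\ne-1$, $\mu\ne-1$, $\mu\ne\lambda$; - $\mathfrak{H}_{13}^{-1;-1}\to\mathfrak{H}_{03}^{-1}$; - $\mathfrak{H}_{14}^{-1}\to\mathfrak{H}_{05}^{-1}$, $\mathfrak{H}_{14}^{-1}\to\mathfrak{H}_{13}^{-1;-1}$; - $\mathfrak{H}_{14}^{\lambda}\to\mathfrak{H}_{10}$ and $\mathfrak{H}_{14}^{\lambda}\to\mathfrak{H}_{13}^{\lambda;-1}$ for $\lambda\ne-1$; - $\mathfrak{H}_{15}\to\mathfrak{H}_{10}$, $\mathfrak{H}_{15}\to\mathfrak{H}_{13}^{0;0}$. Then for $\mathbf{A},\mathbf{B}\in\mathcal{L}$, $\mathbf{A}$ degenerates to $\mathbf{B}$ if and only if there is a directed path in $\Gamma$ (possibly of length zero) from $\mathbf{A}$ to $\mathbf{B}$.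
   Context: An algebra is a finite-dimensional complex vector space with an arbitrary bilinear multiplication. An algebra $\mathfrak{H}$ is a noncommutative Heisenberg algebra if $\dim\mathfrak{H}^2\le1$ and $\mathfrak{H}^2\mathfrak{H}+\mathfrak{H}\mathfrak{H}^2=0$. Let $V=\mathbb{C}^5$. Algebra structures on $V$ are the elements $\mu\in\mathrm{Hom}(V\otimes V,V)\cong\mathbb{C}^{125}$, viewed as an affine space with the Zariski topology. $\mathrm{GL}(V)$ acts on this space by $(g*\mu)(x\otimes y)=g\mu(g^{-1}x\otimes g^{-1}y)$. For algebras $\mathbf{A},\mathbf{B}$ on $V$ represented by structures $\mu,\lambda$, we say $\mathbf{A}$ degenerates to $\mathbf{B}$ if $\lambda$ lies in the Zariski closure of the orbit $\mathrm{GL}(V)*\mu$. This does not depend on the chosen representatives. We set $$\mathbb{C}_{|\cdot|\le 1}=\{x\in\mathbb{C}: |x|<1\}\cup\{x\in\mathbb{C}: |x|=1,\ \mathrm{Im}(x)\ge 0\},$$ $$\mathbb{C}_{\ge 0}=\{x\in\mathbb{C}:\mathrm{Re}(x)>0\}\cup\{x\in\mathbb{C}:\mathrm{Re}(x)=0,\ \mathrm{Im}(x)\ge 0\}.$$ *)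

(* Defs.v *)
From HB Require Import structures.
From mathcomp Require Import all_boot all_order all_algebra.
From mathcomp Require Import Rstruct.
From mathcomp Require Import complex.
From mathcomp Require Import mpoly.
From Stdlib Require Import Relations.

Set Implicit Arguments.
Unset Strict Implicit.
Unset Printing Implicit Defensive.

Import Order.TTheory GRing.Theory Num.Theory.
Local Open Scope ring_scope.

Definition C : Type := (Rdefinitions.R)[i].
HB.instance Definition _ := Num.ClosedField.on C.

Definition in_unit_disc_half (x : C) : Prop :=
  (`|x| < 1) \/ (`|x| = 1 /\ (0 <= Im x)%R).

Definition in_right_half (x : C) : Prop :=
  (0 < Re x)%R \/ (Re x = 0 /\ (0 <= Im x)%R).

(* An algebra structure on V = C^5 (basis e_1..e_5 = indices 0..4):
   mu i j k = coefficient of e_(k+1) in e_(i+1) e_(j+1). *)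
Definition struct5 : Type := 'I_5 -> 'I_5 -> 'I_5 -> C.

(* Action of g in GL(V) (columns = images of basis vectors):
   (g * mu)(x, y) = g mu(g^-1 x, g^-1 y), written in coordinates. *)
Definition gl_act (g : 'M[C]_5) (mu : struct5) : struct5 :=
  fun i j k => \sum_(a < 5) \sum_(b < 5) \sum_(c < 5)
      (invmx g) a i * (invmx g) b j * mu a b c * g k c.

Definition orbit (mu : struct5) : struct5 -> Prop :=
  fun nu => exists g : 'M[C]_5, g \in unitmx /\ nu = gl_act g mu.

(* Identification Hom(V (x) V, V) = C^125 via coordinates. *)
Definition coords (mu : struct5) : 'I_125 -> C :=
  fun n => mu (inord (n %/ 25)) (inord ((n %/ 5) %% 5)) (inord (n %% 5)).

Definition zariski_closure (S : struct5 -> Prop) : struct5 -> Prop :=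
  fun nu => forall p : {mpoly C[125]},
      (forall mu, S mu -> p.@[coords mu] = 0) -> p.@[coords nu] = 0.

Definition degenerates (mu nu : struct5) : Prop :=
  zariski_closure (orbit mu) nu.

(* Noncommutative Heisenberg algebras with all products in C e_5:
   heis s is the structure with e_i e_j = c e_5 for each ((i, j), c) in s
   (1-based indices as in the paper), all other products of basis vectors 0. *)
Definition heis (s : seq (nat * nat * C)) : struct5 :=
  fun i j k => if nat_of_ord k == 4%N then
      \sum_(t <- s | (t.1.1 == i.+1) && (t.1.2 == j.+1)) t.2 else 0.

Inductive alg5 : Type :=
| C5 | H01 | H02 | H03 of C | H04 | H05 of C | H06 | H07 | H08
| H09 of C | H10 | H11 | H12 | H13 of C & C | H14 of C | H15.

Local Open Scope nat_scope.
Definition struct_of (A : alg5) : struct5 :=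
  match A with
  | C5 => fun _ _ _ => 0%R
  | H01 => heis [:: (1, 1, 1%R)]
  | H02 => heis [:: (1, 2, (-1)%R); (2, 1, 1%R); (2, 2, 1%R)]
  | H03 l => heis [:: (1, 2, 1%R); (2, 1, l)]
  | H04 => heis [:: (1, 1, 1%R); (2, 3, (-1)%R); (3, 2, 1%R); (3, 3, 1%R)]
  | H05 l => heis [:: (1, 1, 1%R); (2, 3, 1%R); (3, 2, l)]
  | H06 => heis [:: (1, 2, 1%R); (2, 3, 1%R)]
  | H07 => heis [:: (1, 3, 1%R); (2, 2, (-1)%R); (2, 3, (-1)%R); (3, 1, 1%R); (3, 2, 1%R)]
  | H08 => heis [:: (1, 4, (-1)%R); (2, 3, 1%R); (2, 4, 1%R); (3, 2, (-1)%R);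
                    (3, 3, (-1)%R); (4, 1, 1%R); (4, 2, 1%R)]
  | H09 l => heis [:: (1, 3, 1%R); (2, 4, 1%R); (3, 1, l); (3, 2, 1%R); (4, 2, l)]
  | H10 => heis [:: (1, 1, 1%R); (2, 3, 1%R); (3, 4, 1%R)]
  | H11 => heis [:: (1, 1, 1%R); (2, 4, 1%R); (3, 3, (-1)%R); (3, 4, (-1)%R);
                    (4, 2, 1%R); (4, 3, 1%R)]
  | H12 => heis [:: (1, 2, (-1)%R); (2, 1, 1%R); (2, 2, 1%R); (3, 4, (-1)%R);
                    (4, 3, 1%R); (4, 4, 1%R)]
  | H13 l m => heis [:: (1, 2, 1%R); (2, 1, m); (3, 4, 1%R); (4, 3, l)]
  | H14 l => heis [:: (1, 2, 1%R); (2, 1, l); (3, 4, (-1)%R); (4, 3, 1%R); (4, 4, 1%R)]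
  | H15 => heis [:: (1, 2, 1%R); (2, 3, 1%R); (3, 4, 1%R)]
  end.
Local Open Scope ring_scope.

Definition admissible (A : alg5) : Prop :=
  match A with
  | H03 l | H05 l | H14 l => in_unit_disc_half l
  | H09 l => in_unit_disc_half l /\ l <> -1 /\ l <> 0
  | H13 l m => in_unit_disc_half l /\ in_unit_disc_half m /\ in_right_half (l - m)
  | _ => True
  end.

(* The edges of the graph Gamma (before restricting to vertices in L). *)
Definition gamma_edge (A B : alg5) : Prop :=
  match A, B with
  | H02, H01 => True
  | H02, H03 l => l = -1
  | H03 l, H01 => l <> -1
  | H03 l, C5 => l = -1
  | H01, C5 => True
  | H04, H05 l => l = -1
  | H04, H06 => True
  | H05 l, H06 => l <> 1 /\ l <> -1
  | H05 l, H03 m => l = 1 /\ m = 1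
  | H05 l, H02 => l = -1
  | H06, H02 => True
  | H06, H03 _ => True
  | H07, H05 l => l = 1
  | H07, H06 => True
  | H08, H10 => True
  | H08, H12 => True
  | H09 l, H10 => l <> 1
  | H09 l, H13 m n => m = l /\ n = l
  | H09 l, H07 => l = 1
  | H10, H04 => True
  | H10, H07 => True
  | H10, H05 _ => True
  | H11, H09 l => l = 1
  | H11, H10 => True
  | H12, H04 => True
  | H12, H14 l => l = -1
  | H13 l m, H04 => m = -1 /\ l <> -1
  | H13 l m, H05 n => m = l /\ n = l /\ l <> -1
  | H13 l m, H10 => l <> -1 /\ m <> -1 /\ m <> l
  | H13 l m, H03 n => l = -1 /\ m = -1 /\ n = -1
  | H14 l, H05 n => l = -1 /\ n = -1
  | H14 l, H13 m n => (l = -1 /\ m = -1 /\ n = -1) \/ (l <> -1 /\ m = l /\ n = -1)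
  | H14 l, H10 => l <> -1
  | H15, H10 => True
  | H15, H13 l m => l = 0 /\ m = 0
  | _, _ => False
  end.

Definition Gamma (A B : alg5) : Prop :=
  admissible A /\ admissible B /\ gamma_edge A B.

Definition gamma_path : alg5 -> alg5 -> Prop := clos_refl_trans alg5 Gamma.

(* Main.v *)
Require Import Defs.
From mathcomp Require Import all_boot all_order all_algebra.
From mathcomp Require Import mpoly ring zify.
From Stdlib Require Import Lia Relations FunctionalExtensionality.
Set Implicit Arguments.
Unset Strict Implicit.
Unset Printing Implicit Defensive.

Import Order.TTheory GRing.Theory Num.Theory.
Local Open Scope ring_scope.

(** A noncommutative Heisenberg structure is a bilinear form with matrix [M],
    times the vector [e_5]; on the [e_5]-component of the structure the group
    acts by [M |-> c h^T M h].

    Every edge of the graph is realised by a (possibly singular) constant change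
    of basis followed by a one-parameter subgroup of diagonal matrices.

    Conversely, a linear relation, with constant coefficients, between the
    [k]-minors of finitely many members [x M + y M^T] of the pencil of [M] is
    stable under congruence (by multilinearity of the determinant) and is
    polynomial, so it passes to the Zariski closure. Such relations suffice to
    exclude all missing degenerations: the determinant of the pencil is
    determined up to a scalar, the rank of a member of the pencil does not
    increase, and for [H09 1] the 3-minors satisfy one further relation. *)

(** Transposition commutes with congruence, so a change of basis [h] acts on all members of the
    pencil at once and expands the [k]-minors of each with the same coefficients, products of
    entries of [h]. This is why relations with constant coefficients between minors of different
    members survive. The roots of the determinant of a 2-by-2 block come in pairs [l], [1/l],
    because transposition exchanges [x] and [y]; the half disc contains one number of each pair, and
    the condition on [l - m] orders the two parameters of [H13]. Determinants do not see the Jordan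
    structure: they separate neither [H09 l] from [H13 l l] nor [H08] from [H12]. There the rank of
    the member at a multiple root decides. For [H09 1] this is not enough: [M - M^T] has rank 2, as
    it has for [H04], [H10], [H11] and [H05 n] with [n <> 1], and all members that are not multiples
    of it have full rank 4. Only the relation of degree three excludes these algebras. *)

(** * Structures as matrices, and the group action *)

Definition heis_of_mx (M : 'M[C]_5) : struct5 :=
  fun i j k => if nat_of_ord k == 4%N then M i j else 0.

Definition form (s : seq (nat * nat * C)) : 'M[C]_5 :=
  \matrix_(i, j) \sum_(t <- s | (t.1.1 == i.+1) && (t.1.2 == j.+1)) t.2.

Lemma struct5P (mu nu : struct5) :
  (forall i j k, mu i j k = nu i j k) -> mu = nu.
Proof.
by move=> h; do 3! (apply: functional_extensionality => ?); apply: h.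
Qed.

Lemma heisE s : heis s = heis_of_mx (form s).
Proof. by apply: struct5P => i j k; rewrite /heis_of_mx mxE. Qed.

Definition coord_index (i j k : 'I_5) : 'I_125 := inord (25 * i + 5 * j + k).

Lemma coords_index mu i j k : coords mu (coord_index i j k) = mu i j k.
Proof.
have [hi hj hk] : [/\ i < 5, j < 5 & k < 5]%N by split.
have lt125 : (25 * i + 5 * j + k < 125)%N by lia.
rewrite /coords /coord_index inordK //.
have e1 : (25 * i + 5 * j + k = (i * 5 + j) * 5 + k)%N.
  by lia.
have e2 : ((25 * i + 5 * j + k) %/ 5 = i * 5 + j)%N.
  by rewrite e1 divnMDl // divn_small ?addn0.
have -> : ((25 * i + 5 * j + k) %/ 25 = i)%N.
  by rewrite -[25%N]/(5 * 5)%N divnMA e2 divnMDl // divn_small ?addn0.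
rewrite e2 modnMDl modn_small // e1 modnMDl modn_small //.
by rewrite !inord_val.
Qed.

Definition slice (mu : struct5) (k : 'I_5) : 'M[C]_5 := \matrix_(i, j) mu i j k.

Lemma slice_gl g mu k : slice (gl_act g mu) k =
  \sum_c g k c *: ((invmx g)^T *m slice mu c *m invmx g).
Proof.
apply/matrixP=> i j; rewrite mxE /gl_act summxE.
under [RHS]eq_bigr => c _.
  rewrite !mxE big_distrr /=.
  under eq_bigr => b _.
    rewrite !mxE big_distrl big_distrr /=; over.
  over.
rewrite [RHS]exchange_big /= [LHS]exchange_big /=; apply: eq_bigr => b _.
rewrite [RHS]exchange_big /=; apply: eq_bigr => a _; apply: eq_bigr => c _.
by rewrite !mxE; ring.
Qed.

Lemma slice_inj mu nu : (forall k, slice mu k = slice nu k) -> mu = nu.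
Proof.
by move=> h; apply: struct5P => i j k; have /matrixP/(_ i j) := h k; rewrite !mxE.
Qed.

Lemma gl_actM g h mu : g \in unitmx -> h \in unitmx ->
  gl_act g (gl_act h mu) = gl_act (g *m h) mu.
Proof.
move=> ug uh; apply: slice_inj => k; rewrite !slice_gl.
have -> : invmx (g *m h) = invmx h *m invmx g.
  exact: (@invrM 'M[C]_5 g h ug uh).
under eq_bigr => c _.
  rewrite slice_gl mulmx_sumr mulmx_suml scaler_sumr; over.
rewrite exchange_big /=; apply: eq_bigr => d _.
rewrite mxE scaler_suml; apply: eq_bigr => c _.
by rewrite -scalemxAr -scalemxAl scalerA trmx_mul !mulmxA.
Qed.

Lemma gl_act_hs g (M : 'M[C]_5) i j k :
  gl_act g (heis_of_mx M) i j k =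
  g k ord_max * ((invmx g)^T *m M *m invmx g) i j.
Proof.
have -> : gl_act g (heis_of_mx M) i j k = slice (gl_act g (heis_of_mx M)) k i j by rewrite mxE.
rewrite slice_gl summxE (bigD1 ord_max) //= big1 ?addr0 => [|c nc].
  by rewrite mxE; congr (_ * (_ *m _ *m _) _ _); apply/matrixP=> a b; rewrite mxE.
rewrite mxE (_ : slice _ c = 0) ?mulmx0 ?mul0mx ?mxE ?mulr0 //.
apply/matrixP=> a b; rewrite !mxE /heis_of_mx; case: eqP => // e.
by case/eqP: nc; apply: val_inj.
Qed.

(** For fixed [g] the action is linear in the coordinates, so [p] composed with it is again a
    polynomial. It vanishes on the orbit of [mu], hence at [nu]: the closure of an orbit is stable
    under the group. *)
Lemma degenerates_trans mu nu xi :
  degenerates mu nu -> degenerates nu xi -> degenerates mu xi.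
Proof.
move=> h1 h2 p hp; apply: h2 => _ [g [ug ->]].
pose lin (n : 'I_125) : {mpoly C[125]} :=
  \sum_(a < 5) \sum_(b < 5) \sum_(c < 5)
    ((invmx g) a (inord (n %/ 25)) * (invmx g) b (inord ((n %/ 5) %% 5))
     * g (inord (n %% 5)) c) *: 'X_(coord_index a b c).
have ev la : p.@[coords (gl_act g la)] =
    (p \mPo [tuple lin n | n < 125]).@[coords la].
  rewrite comp_mpoly_meval; apply: meval_eq => n.
  rewrite tnth_mktuple [LHS]/coords [LHS]/gl_act !raddf_sum; apply: eq_bigr => a _.
  rewrite !raddf_sum; apply: eq_bigr => b _; rewrite !raddf_sum.
  apply: eq_bigr => c _.
  by rewrite /= mevalZ mevalXU coords_index; ring.
rewrite ev; apply: h1 => _ [h [uh ->]]; rewrite -ev gl_actM //; apply: hp.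
by exists (g *m h); rewrite unitmx_mul ug uh.
Qed.

Lemma degenerates_refl mu : degenerates mu mu.
Proof.
move=> p hp; apply: hp; exists 1%:M; split; first exact: unitmx1.
apply: slice_inj => k; rewrite slice_gl invmx1 trmx1 (bigD1 k) //= big1.
  by rewrite mxE eqxx scale1r mul1mx mulmx1 addr0.
by move=> c; rewrite mxE eq_sym => /negPf->; rewrite scale0r.
Qed.

(** * Limits along curves in an orbit *)

(** Fixing [e_5] makes the scalar [c] in [M |-> c h^T M h] equal to 1. For forms that do not involve
    [e_5] nothing is lost: a square root of [c] can be absorbed into the other basis vectors. *)
Definition fixes_e5 (h : 'M[C]_5) := h *m delta_mx ord_max (0 : 'I_1) = delta_mx ord_max 0.

Lemma orbit_congr h M : h \in unitmx -> fixes_e5 h ->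
  Defs.orbit (heis_of_mx M) (heis_of_mx (h^T *m M *m h)).
Proof.
move=> uh h5; exists (invmx h); split; first by rewrite unitmx_inv.
apply: struct5P => i j k; rewrite gl_act_hs invmxK.
have /matrixP/(_ k 0) : invmx h *m delta_mx ord_max (0 : 'I_1) = delta_mx ord_max 0.
  by rewrite -[in LHS]h5 mulKmx.
rewrite -colE ![col _ _ _ _]mxE mxE andbT /heis_of_mx => ->; rewrite -val_eqE /=.
by case: eqP => _; rewrite ?mul1r ?mul0r.
Qed.

Lemma poly_fun0 (p : {poly C}) : (forall t, p.[t] = 0) -> p = 0.
Proof.
move=> h; apply: (@roots_geq_poly_eq0 _ _ [seq i%:R | i <- iota 0 (size p)]).
- by apply/allP=> x _; apply/eqP/h.
- by rewrite map_inj_uniq ?iota_uniq // => i j /eqP; rewrite eqr_nat => /eqP.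
- by rewrite size_map size_iota.
Qed.

(** Along the curve, a polynomial that vanishes on the orbit becomes a polynomial [r] in one
    variable, zero wherever [q] is not. Hence the product of [q] and [r] vanishes everywhere and
    [r = 0], also at [0], where [q] may vanish and the curve may leave the orbit. *)
Lemma degenerates_curve (M : 'M[C]_5) (P : 'M[{poly C}]_5) (q : {poly C}) :
  q != 0 ->
  (forall t, q.[t] != 0 -> exists h, [/\ h \in unitmx, fixes_e5 h &
     map_mx (horner_eval t) P = h^T *m M *m h]) ->
  degenerates (heis_of_mx M) (heis_of_mx (map_mx (horner_eval 0) P)).
Proof.
move=> q0 hP p hp.
pose v (n : 'I_125) : {poly C} :=
  if nat_of_ord (inord (n %% 5) : 'I_5) == 4%N
  then P (inord (n %/ 25)) (inord ((n %/ 5) %% 5)) else 0.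
pose r := \sum_(m <- msupp p) (p@_m)%:P * \prod_i v i ^+ m i.
have rE t : r.[t] = p.@[coords (heis_of_mx (map_mx (horner_eval t) P))].
  rewrite /r horner_sum mevalE; apply: eq_bigr => m _.
  rewrite hornerM hornerC horner_prod; congr (_ * _); apply: eq_bigr => n _.
  rewrite horner_exp /coords /heis_of_mx /v; congr (_ ^+ _).
  by case: ifP => _; rewrite ?mxE ?horner0.
have : q * r = 0.
  apply: poly_fun0 => t; rewrite hornerM; have [->|qt] := eqVneq q.[t] 0.
    by rewrite mul0r.
  have [h [uh h5 e]] := hP t qt.
  by rewrite rE e (hp _ (orbit_congr M uh h5)) mulr0.
move/eqP; rewrite mulf_eq0 (negPf q0) /= => /eqP r0.
by rewrite -rE r0 horner0.
Qed.

(* The change of basis [h] may be singular: it is a limit of invertible ones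
   along the line joining it to the identity. *)
Lemma degenerates_congr h M : fixes_e5 h ->
  degenerates (heis_of_mx M) (heis_of_mx (h^T *m M *m h)).
Proof.
move=> h5.
pose H : 'M[{poly C}]_5 := map_mx polyC h + 'X *: map_mx polyC (1%:M - h).
have HE t : map_mx (horner_eval t) H = h + t *: (1%:M - h).
  by apply/matrixP=> i j; rewrite !mxE /horner_eval !hornerE.
have HME t : map_mx (horner_eval t) (H^T *m map_mx polyC M *m H) =
    (h + t *: (1%:M - h))^T *m M *m (h + t *: (1%:M - h)).
  rewrite !map_mxM -map_trmx HE; congr (_ *m _ *m _).
  by apply/matrixP=> i j; rewrite !mxE /= /horner_eval hornerC.
have detE t : (\det H).[t] = \det (h + t *: (1%:M - h)).
  by rewrite -HE -[LHS]/(horner_eval t _) -det_map_mx.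
have := @degenerates_curve M (H^T *m map_mx polyC M *m H) (\det H).
rewrite HME scale0r addr0; apply.
  apply/eqP=> d0; have := detE 1; rewrite d0 horner0 scale1r addrC subrK det1.
  by move/eqP; rewrite eq_sym oner_eq0.
move=> t; rewrite detE => dt; exists (h + t *: (1%:M - h)); split.
- by rewrite unitmxE unitfE.
- by rewrite /fixes_e5 mulmxDl -scalemxAl mulmxBl mul1mx h5 subrr scaler0 addr0.
- exact: HME.
Qed.

(** The diagonal matrix with entries [t^(u i - 1)] multiplies entry [(i, j)] by [t^(u i + u j - 2)].
    Entries with a negative exponent must be absent, those with a positive one die at [t = 0], and
    those with exponent 0 remain. *)
Lemma degenerates_weights (u : 'I_5 -> nat) (M : 'M[C]_5) :
  u ord_max = 1%N -> (forall i j, (u i + u j < 2)%N -> M i j = 0) ->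
  degenerates (heis_of_mx M)
    (heis_of_mx (\matrix_(i, j) if (u i + u j == 2)%N then M i j else 0)).
Proof.
move=> u5 hM.
(* The subtraction truncates only where [hM] makes the entry zero. *)
pose P : 'M[{poly C}]_5 := \matrix_(i, j) ((M i j)%:P * 'X^(u i + u j - 2)).
have -> : (\matrix_(i, j) if (u i + u j == 2)%N then M i j else 0) =
    map_mx (horner_eval 0) P.
  apply/matrixP=> i j; rewrite !mxE /horner_eval !hornerE expr0n subn_eq0.
  have [lt|gt|e] := ltngtP (u i + u j)%N 2%N; rewrite ?mulr1 ?mulr0 //.
  by rewrite hM.
apply: (@degenerates_curve _ _ 'X); first by rewrite polyX_eq0.
move=> t; rewrite hornerX => t0.
pose D : 'M[C]_5 := diag_mx (\row_i (t ^+ u i / t)).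
exists D; split.
- rewrite unitmxE unitfE det_diag; apply/prodf_neq0 => i _.
  by rewrite mxE mulf_neq0 ?invr_neq0 ?expf_neq0.
- rewrite /fixes_e5 mul_diag_mx; apply/matrixP=> i j; rewrite !mxE.
  by case: (i =P ord_max) => [->|_] /=; rewrite ?mulr0 ?u5 ?expr1 ?divff ?mul1r.
- rewrite tr_diag_mx mul_diag_mx mul_mx_diag; apply/matrixP=> i j.
  rewrite !mxE /horner_eval !hornerE /=.
  have [lt|le2] := ltnP (u i + u j) 2; first by rewrite hM // !(mulr0, mul0r).
  have e : t ^+ u i * t ^+ u j = t ^+ (u i + u j - 2) * (t * t).
    by rewrite -exprD -[in LHS](subnK le2) exprD expr2.
  transitivity (M i j * (t ^+ u i * t ^+ u j) / (t * t)); last by field.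
  by rewrite e; field.
Qed.

(** * Degenerations from explicit bases and weights *)

(** Indices are 1-based: the lower bound makes [.-1] faithful, the upper one keeps [e_5] out of the
    form. *)
Definition in_C4 (s : seq (nat * nat * C)) :=
  all (fun t => (0 < t.1.1 < 5)%N && (0 < t.1.2 < 5)%N) s.

(* Folds rather than big operators, so that they compute on explicit lists. *)
Definition bilin (s : seq (nat * nat * C)) (x y : seq C) : C :=
  foldr (fun t c => t.2 * x`_(t.1.1.-1) * y`_(t.1.2.-1) + c) 0 s.

Definition entry (s : seq (nat * nat * C)) (i j : nat) : C :=
  foldr (fun t c => if (t.1.1 == i.+1) && (t.1.2 == j.+1) then t.2 + c else c)
        0 s.

Lemma bilinE s x y :
  bilin s x y = \sum_(t <- s) t.2 * x`_(t.1.1.-1) * y`_(t.1.2.-1).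
Proof. by elim: s => [|t s IH]; rewrite ?big_nil ?big_cons //= IH. Qed.

Lemma entryE s (i j : 'I_5) : entry s i j = form s i j.
Proof.
by rewrite mxE; elim: s => [|t s IH]; rewrite ?big_nil ?big_cons //= IH.
Qed.

Lemma entry_out s i j : in_C4 s -> (3 < maxn i j)%N -> entry s i j = 0.
Proof.
move=> + mij; elim: s => //= t s IH /andP[/andP[/andP[_ h1] /andP[_ h2]]] /IH->.
case: ifP => // /andP[/eqP e1 /eqP e2]; move: mij.
by rewrite leq_max -ltnS -e1 -[(3 < j)%N]ltnS -e2 !ltnNge (h1 : (t.1.1 <= 4)%N) (h2 : (t.1.2 <= 4)%N).
Qed.

Lemma congr_form s (h : 'M[C]_5) i j : in_C4 s ->
  (h^T *m form s *m h) i j =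
  \sum_(t <- s) t.2 * h (inord t.1.1.-1) i * h (inord t.1.2.-1) j.
Proof.
move=> s4; rewrite mxE; under eq_bigr => b _.
  rewrite !mxE big_distrl /=.
  under eq_bigr => a _.
    rewrite !mxE big_mkcond big_distrr big_distrl /=; over.
  over.
under eq_bigr => b _ do rewrite exchange_big.
rewrite exchange_big /=; apply: eq_big_seq => t.
move=> /(allP s4) /andP[/andP[h1 h1'] /andP[h2 h2']].
have e1 : t.1.1 = (inord t.1.1.-1 : 'I_5).+1 by rewrite inordK prednK // ltnW.
have e2 : t.1.2 = (inord t.1.2.-1 : 'I_5).+1 by rewrite inordK prednK // ltnW.
rewrite (bigD1 (inord t.1.2.-1)) //= (bigD1 (inord t.1.1.-1)) //=.
rewrite -e1 -e2 !eqxx /= !big1 ?addr0 => [|b /negPf nb|a /negPf na].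
- by ring.
- rewrite big1 // => a _.
  by rewrite {1}e2 eqSS val_eqE [_ == b]eq_sym nb andbF mulr0 mul0r.
- by rewrite {1}e1 eqSS val_eqE [_ == a]eq_sym na mulr0 mul0r.
Qed.

(* The rows of [E] are the new basis vectors; [u] gives the weights of a
   one-parameter subgroup, shifted by one so that they are natural numbers. *)
Lemma degenerates_basis (E : seq (seq C)) (u : seq nat) s s' :
  in_C4 s -> in_C4 s' ->
  (forall i j, (i < 4)%N -> (j < 4)%N ->
     match (nth 0 u i + nth 0 u j)%N with
     | 0 | 1 => bilin s (nth [::] E i) (nth [::] E j) = 0 /\ entry s' i j = 0
     | 2 => bilin s (nth [::] E i) (nth [::] E j) = entry s' i j
     | _ => entry s' i j = 0
     end) ->
  degenerates (heis s) (heis s').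
Proof.
move=> s4 s4' hE; rewrite !heisE.
(* Vectors missing from [E], and missing coordinates, read as 0. A target form in fewer than four
   variables thus needs fewer vectors, and [h] is then singular. *)
pose h : 'M[C]_5 := \matrix_(a, i) if (i < 4)%N then (if (a < 4)%N then (nth [::] E i)`_a else 0)
                                   else (a == ord_max)%:R.
have h5 : fixes_e5 h.
  by apply/matrixP=> i j; rewrite -colE !mxE ord1 andbT.
refine (degenerates_trans (@degenerates_congr h (form s) h5) _).
have hB (i j : 'I_5) : (h^T *m form s *m h) i j =
    if ((i < 4) && (j < 4))%N then bilin s (nth [::] E i) (nth [::] E j) else 0.
  rewrite congr_form // bilinE.
  have val1 n : (0 < n < 5)%N -> nat_of_ord (inord n.-1 : 'I_5) = n.-1.
    by case/andP=> n0 n5; rewrite inordK // prednK // ltnW.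
  case: ifP => [/andP[hi hj]|/negbT nij].
    apply: eq_big_seq => t /(allP s4) /andP[h1 h2].
    rewrite !mxE hi hj !val1 //; case/andP: h1 => h1 h1'; case/andP: h2 => h2 h2'.
    by rewrite !prednK // (h1' : (t.1.1 <= 4)%N) (h2' : (t.1.2 <= 4)%N).
  rewrite big_seq big1 // => t /(allP s4) /andP[h1 h2].
  have not5 n : (0 < n < 5)%N -> (inord n.-1 == ord_max :> 'I_5) = false.
    by move=> n5; rewrite -val_eqE /= val1 //; case: n n5 => [|[|[|[|[|n]]]]].
  by move: nij; rewrite negb_and !mxE !not5 // => /orP[]/negPf->; rewrite !(mulr0, mul0r).
pose w (i : 'I_5) := (if i < 4 then nth 0 u i else 1)%N.
have -> : form s' = \matrix_(i, j) if (w i + w j == 2)%N then (h^T *m form s *m h) i j else 0.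
  apply/matrixP=> i j; rewrite [RHS]mxE -entryE hB /w.
  have [hi|hi] := ltnP i 4; last by rewrite entry_out ?if_same // leq_max hi.
  have [hj|hj] := ltnP j 4; last by rewrite entry_out ?if_same // leq_max hj orbT.
  have := hE i j hi hj.
  by case: (_ + _)%N => [[]|[[]|[|n]]] //=.
apply: degenerates_weights => // i j; rewrite hB /w.
have [hi|hi] := ltnP i 4; last by [].
have [hj|hj] := ltnP j 4; last by [].
have := hE i j hi hj.
by case: (_ + _)%N => [[]|[[]|[|n]]].
Qed.

(** * The edges of the graph are degenerations *)

Ltac family E u :=
  refine (@degenerates_basis E u _ _ _ _ _); [by []|by []|];
  move=> [|[|[|[|?]]]] // [|[|[|[|?]]]] // _ _;
  rewrite /addn /=; try split.

Lemma heis0 : struct_of C5 = heis [::].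
Proof. by apply: struct5P => i j k; rewrite /heis big_nil; case: ifP. Qed.

Lemma degenerates_C5 A : degenerates (struct_of A) (struct_of C5).
Proof.
rewrite heis0; case: A => [|||l||l||||l||||l m|l|]; rewrite ?heis0.
all: family (@nil (seq C)) [:: 1; 1; 1; 1]%N; ring.
Qed.

Lemma sqrt_m1 : exists w : C, w * w = -1.
Proof. by exists 'i; rewrite -expr2 sqrCi. Qed.

Lemma sqrt_inv (d : C) : d != 0 -> exists r : C, r * r * d = 1.
Proof.
by move=> d0; exists (sqrtC d^-1); rewrite -expr2 sqrtCK mulVf.
Qed.

Lemma degenerates_02_01 : degenerates (struct_of H02) (struct_of H01).
Proof. by family [:: [:: 0; 1 : C]] [:: 1; 1; 1; 1]%N; ring. Qed.

Lemma degenerates_02_03 : degenerates (struct_of H02) (struct_of (H03 (-1))).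
Proof. by family [:: [:: -1 : C]; [:: 0; 1]] [:: 0; 2; 1; 1]%N; ring. Qed.

Lemma degenerates_03_01 l : l + 1 != 0 ->
  degenerates (struct_of (H03 l)) (struct_of H01).
Proof.
by move=> l1; family [:: [:: 1; (l + 1)^-1]] [:: 1; 1; 1; 1]%N; field.
Qed.

Lemma degenerates_04_05 : degenerates (struct_of H04) (struct_of (H05 (-1))).
Proof.
by family [:: [:: 1 : C]; [:: 0; -1]; [:: 0; 0; 1]] [:: 1; 0; 2; 1]%N; ring.
Qed.

(** The second vector [v] is isotropic. The first pairs with it to 1 from the left and to 0 from the
    right, the third the other way round; the weights 2, 0, 2 kill the products not involving [v].
    The other limits to [H06] with these weights are built in the same way. *)
Lemma degenerates_04_06 : degenerates (struct_of H04) (struct_of H06).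
Proof.
have [w w2] := sqrt_m1.
by family [:: [:: 1 / 2; w / 2]; [:: 1; 0; w]; [:: 1 / 2; - w / 2]]
          [:: 2; 0; 2; 1]%N; field: w2.
Qed.

Lemma degenerates_05_06 l : l - 1 != 0 -> l + 1 != 0 ->
  degenerates (struct_of (H05 l)) (struct_of H06).
Proof.
move=> l1 l2.
by family [:: [:: - (l - 1)^-1; 0; (l - 1)^-1]; [:: 1; 1; - (l + 1)^-1];
              [:: l / (l - 1); 0; - (l - 1)^-1]] [:: 2; 0; 2; 1]%N;
  field; rewrite ?l1 ?l2.
Qed.

Lemma degenerates_05_03 : degenerates (struct_of (H05 1)) (struct_of (H03 1)).
Proof. by family [:: [:: 0; 1 : C]; [:: 0; 0; 1]] [:: 1; 1; 1; 1]%N; ring. Qed.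

Lemma degenerates_05_02 : degenerates (struct_of (H05 (-1))) (struct_of H02).
Proof. by family [:: [:: 0; -1 : C]; [:: 1; 0; 1]] [:: 1; 1; 1; 1]%N; ring. Qed.

Lemma degenerates_06_02 : degenerates (struct_of H06) (struct_of H02).
Proof. by family [:: [:: -1 : C; 0; 1]; [:: 1; 1; 0]] [:: 1; 1; 1; 1]%N; ring. Qed.

(** The forms [H03 l] are restrictions of [H06] to planes, so all weights are 1 and no proper limit
    is taken. [H10] restricts to [H05 l] in the same way. *)
Lemma degenerates_06_03 l : degenerates (struct_of H06) (struct_of (H03 l)).
Proof. by family [:: [:: 1; 0; l]; [:: 0; 1]] [:: 1; 1; 1; 1]%N; ring. Qed.

Lemma degenerates_07_05 : degenerates (struct_of H07) (struct_of (H05 1)).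
Proof.
have [w w2] := sqrt_m1.
by family [:: [:: 0; w]; [:: 1]; [:: 0; 0; 1]] [:: 1; 0; 2; 1]%N; ring: w2.
Qed.

Lemma degenerates_07_06 : degenerates (struct_of H07) (struct_of H06).
Proof.
by family [:: [:: 0; - (1 / 2 : C)]; [:: 1 / 2; 1; 1]; [:: 1; 1 / 2]]
          [:: 2; 0; 2; 1]%N; field.
Qed.

(** All limits to [H10] share the weights 1, 2, 0, 2. The third vector [v] is isotropic; the first
    has square 1 and is orthogonal to [v] on both sides; the second pairs with [v] to 1 from the
    left only, the fourth from the right only. All other products die. *)
Lemma degenerates_08_10 : degenerates (struct_of H08) (struct_of H10).
Proof.
have [w w2] := sqrt_m1.
by family [:: [:: 0; 0; w]; [:: - (1 / 2); 1 / 2]; [:: 0; 0; 0; 1];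
              [:: 1 / 2; 1 / 2]] [:: 1; 2; 0; 2]%N; field: w2.
Qed.

(* The plane spanned by e_1, e_2 is totally isotropic; contracting along it
   kills e_3 e_3, and the remaining form is congruent to that of H12. *)
Lemma degenerates_08_12 : degenerates (struct_of H08) (struct_of H12).
Proof.
have [w w2] := sqrt_m1.
apply: (@degenerates_trans _ (heis [:: (1, 4, -1); (2, 3, 1); (2, 4, 1);
                                 (3, 2, -1); (4, 1, 1); (4, 2, 1)])).
  by family [:: [:: 1 : C]; [:: 0; 1]; [:: 0; 0; 1]; [:: 0; 0; 0; 1]]
            [:: 0; 0; 2; 2]%N; ring.
by family [:: [:: 1; 0; 1 / 2]; [:: 0; 1; 0; 1 / 2]; [:: w; 0; - w / 2];
              [:: 0; w; 0; - w / 2]] [:: 1; 1; 1; 1]%N; field: w2.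
Qed.

Lemma degenerates_09_10 l : l - 1 != 0 -> l + 1 != 0 ->
  degenerates (struct_of (H09 l)) (struct_of H10).
Proof.
move=> l1 l2.
(* Without the factor [r] the first vector has square [(l + 1)^3 (1 - l)], which [r] normalises to
   1. *)
have [|r hr] := @sqrt_inv ((l + 1) ^+ 3 * (1 - l)).
  by rewrite mulf_neq0 ?expf_neq0 // -opprB oppr_eq0.
by family [:: [:: r * (l * (l + 1)); r * ((l + 1) * (1 - l ^+ 2)); 0; r];
              [:: 1; - l]; [:: 1; - (l + 1); 1; 0]; [:: 0; 1]]
          [:: 1; 2; 0; 2]%N; first [by ring | by rewrite [RHS]addr0 -[RHS]hr; ring].
Qed.

(** In the order [e_1, e_3, e_2, e_4] the form is that of [H13 l l] plus the product [e_3 e_2],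
    which couples the two blocks. The weights of its factors add up to 3, so it dies. *)
Lemma degenerates_09_13 l : degenerates (struct_of (H09 l)) (struct_of (H13 l l)).
Proof.
by family [:: [:: 1 : C]; [:: 0; 0; 1]; [:: 0; 1]; [:: 0; 0; 0; 1]]
          [:: 1; 1; 2; 0]%N; ring.
Qed.

Lemma degenerates_09_07 : degenerates (struct_of (H09 1)) (struct_of H07).
Proof.
by family [:: [:: 1 : C]; [:: 0; 2; 0; - (1 / 4)]; [:: 0; 0; 1; - (1 / 2)]]
          [:: 1; 1; 1; 1]%N; field.
Qed.

Lemma degenerates_10_04 : degenerates (struct_of H10) (struct_of H04).
Proof.
by family [:: [:: 1 : C]; [:: 0; -1; 0; 1]; [:: 0; 1; 1]] [:: 1; 1; 1; 1]%N;
  ring.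
Qed.

Lemma degenerates_10_07 : degenerates (struct_of H10) (struct_of H07).
Proof.
have [w w2] := sqrt_m1.
by family [:: [:: 0; 1; 0; 1]; [:: w; -1; 0; 1]; [:: 0; 0; 1]]
          [:: 1; 1; 1; 1]%N; ring: w2.
Qed.

Lemma degenerates_10_05 l : degenerates (struct_of H10) (struct_of (H05 l)).
Proof.
by family [:: [:: 1]; [:: 0; 1; 0; l]; [:: 0; 0; 1]] [:: 1; 1; 1; 1]%N; ring.
Qed.

(** The first two new vectors span a totally isotropic plane. Weight 0 on it and weight 2 on the
    other two vectors kill all products within the complementary plane. *)
Lemma degenerates_11_09 : degenerates (struct_of H11) (struct_of (H09 1)).
Proof.
by family [:: [:: 0; 2 : C]; [:: 1; 1; 1]; [:: 0; 0; 0; 1 / 2];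
              [:: 1 / 2; 0; - (1 / 2)]] [:: 0; 0; 2; 2]%N; field.
Qed.

Lemma degenerates_11_10 : degenerates (struct_of H11) (struct_of H10).
Proof.
by family [:: [:: 1 : C]; [:: 0; 1 / 2; - (1 / 2)]; [:: 0; 0; 0; 1];
              [:: 0; 1 / 2; 1 / 2]] [:: 1; 2; 0; 2]%N; field.
Qed.

Lemma degenerates_12_04 : degenerates (struct_of H12) (struct_of H04).
Proof.
by family [:: [:: 0; 1 : C]; [:: 0; 0; 1]; [:: 0; 0; 0; 1]]
          [:: 1; 1; 1; 1]%N; ring.
Qed.

Lemma degenerates_12_14 : degenerates (struct_of H12) (struct_of (H14 (-1))).
Proof.
by family [:: [:: -1 : C]; [:: 0; 1]; [:: 0; 0; 1]; [:: 0; 0; 0; 1]]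
          [:: 0; 2; 1; 1]%N; ring.
Qed.

(** The symmetric part has radical spanned by [e_1, e_2]. Modulo this radical the first and third
    vectors are an orthonormal basis for it, while [e_2] carries the skew pairing. The
    [e_2]-component of the first vector cancels its remaining skew product with the third. *)
Lemma degenerates_13_04 l : l + 1 != 0 ->
  degenerates (struct_of (H13 l (-1))) (struct_of H04).
Proof.
move=> l1; have [w w2] := sqrt_m1.
by family [:: [:: 0; w * (1 - l) / (l + 1); w / 2; - (2 * w / (l + 1))];
              [:: 0; 1]; [:: 1; 0; 1 / 2; 2 / (l + 1)]]
          [:: 1; 1; 1; 1]%N; field: w2.
Qed.

Lemma degenerates_13_05 l : l + 1 != 0 ->
  degenerates (struct_of (H13 l l)) (struct_of (H05 l)).
Proof.
by move=> l1; family [:: [:: 0; 0; 1; (l + 1)^-1]; [:: 1]; [:: 0; 1]]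
                     [:: 1; 1; 1; 1]%N; field.
Qed.

Lemma degenerates_13_10 l m : l + 1 != 0 -> m + 1 != 0 -> l - m != 0 ->
  1 - l * m != 0 -> degenerates (struct_of (H13 l m)) (struct_of H10).
Proof.
move=> l1 m1 lm lm1.
(* As before, [r] normalises the square of the first vector, here [(m + 1) (1 - l m) (l - m)]. *)
have [|r hr] := @sqrt_inv ((m + 1) * (1 - l * m) * (l - m)).
  by rewrite !mulf_neq0.
by family [:: [:: r * (1 - l * m); r * (l - m); r * ((1 - m) * (l + 1)); 0];
              [:: (1 - l * m)^-1; 0; 0; - (m / (1 - l * m))];
              [:: 1; 1; 1; - ((m + 1) / (l + 1))];
              [:: - (l / (1 - l * m)); 0; 0; (1 - l * m)^-1]]
          [:: 1; 2; 0; 2]%N;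
  first [by ring | by rewrite [RHS]addr0 -[RHS]hr; ring | by field; rewrite ?l1 ?lm1].
Qed.

Lemma degenerates_13_03 l m : degenerates (struct_of (H13 l m)) (struct_of (H03 m)).
Proof. by family [:: [:: 1 : C]; [:: 0; 1]] [:: 1; 1; 1; 1]%N; ring. Qed.

Lemma degenerates_14_05 l : degenerates (struct_of (H14 l)) (struct_of (H05 l)).
Proof.
by family [:: [:: 0; 0; 0; 1 : C]; [:: 1]; [:: 0; 1]] [:: 1; 1; 1; 1]%N; ring.
Qed.

Lemma degenerates_14_13 l : degenerates (struct_of (H14 l)) (struct_of (H13 l (-1))).
Proof.
by family [:: [:: 0; 0; -1 : C]; [:: 0; 0; 0; 1]; [:: 1]; [:: 0; 1]]
          [:: 0; 2; 1; 1]%N; ring.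
Qed.

Lemma degenerates_14_10 l : l + 1 != 0 -> degenerates (struct_of (H14 l)) (struct_of H10).
Proof.
move=> l1.
by family [:: [:: 1; (l + 1)^-1; - (1 - l) / (l + 1)];
              [:: 0; 0; - (1 / 2); 1 / 2]; [:: 1; - (l + 1)^-1; 0; 1];
              [:: 0; 0; 1 / 2; 1 / 2]] [:: 1; 2; 0; 2]%N; field.
Qed.

Lemma degenerates_15_10 : degenerates (struct_of H15) (struct_of H10).
Proof.
by family [:: [:: 0; 0; 1 : C; 1]; [:: 1]; [:: 1; 1; -1]; [:: 0; 0; 0; -1]]
          [:: 1; 2; 0; 2]%N; ring.
Qed.

Lemma degenerates_15_13 : degenerates (struct_of H15) (struct_of (H13 0 0)).
Proof.
by family [:: [:: 1 : C]; [:: 0; 1]; [:: 0; 0; 1]; [:: 0; 0; 0; 1]]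
          [:: 0; 2; 2; 0]%N; ring.
Qed.

(** * The parameter domains *)

(** Both numbers must lie on the unit circle, so [m] is the conjugate of [l]. As both imaginary
    parts are nonnegative, [l] is real and equals its conjugate. *)
Lemma disc_inv (l m : C) :
  in_unit_disc_half l -> in_unit_disc_half m -> l * m = 1 -> l = m.
Proof.
move=> hl hm lm.
have nlm : `|l| * `|m| = 1 by rewrite -normrM lm normr1.
have {}hl : `|l| = 1 /\ 0 <= Im l.
  case: hl => // l1; have : `|l| * `|m| < 1.
    by case: hm => [m1|[-> _]]; rewrite ?mulr1 // mulr_ilt1.
  by rewrite nlm ltxx.
have {}hm : 0 <= Im m.
  by case: hm => [|[]] //; move: nlm; rewrite hl.1 mul1r => ->; rewrite ltxx.
case: hl => l1 hl.
have mE : m = l^*.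
  have l0 : l != 0 by rewrite -normr_eq0 l1 oner_eq0.
  by apply: (mulfI l0); rewrite lm -normCK l1 expr1n.
have : l \is Num.real.
  apply/Creal_ImP/eqP; rewrite eq_le hl andbT -oppr_ge0.
  by move: hm; rewrite mE Im_conj.
by rewrite mE => /conj_Creal->.
Qed.

(** This makes the condition on [l - m] choose one order of the two parameters of [H13]. *)
Lemma right_half_anti (x : C) :
  in_right_half x -> in_right_half (- x) -> x = 0.
Proof.
rewrite /in_right_half !raddfN /= !oppr_gt0 !oppr_ge0 => h1 h2.
rewrite [x]Crect; case: h1 h2 => [a0|[-> b0]]; case=> [a1|[/eqP a1 b1]].
- by have := lt_trans a0 a1; rewrite ltxx.
- by move: a1; rewrite oppr_eq0 => /eqP a1; rewrite a1 ltxx in a0.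
- by rewrite ltxx in a1.
- by rewrite add0r (le_anti (introT andP (conj b1 b0))) mulr0.
Qed.

Lemma disc1 : in_unit_disc_half 1.
Proof. by right; rewrite normr1 (Creal_ImP _ (rpred1 _)). Qed.

Lemma discN1 : in_unit_disc_half (-1).
Proof. by right; rewrite normrN1 (Creal_ImP _ _) // rpredN rpred1. Qed.

Lemma disc0 : in_unit_disc_half 0.
Proof. by left; rewrite normr0 ltr01. Qed.

Lemma right_half_subrr (x : C) : in_right_half (x - x).
Proof. by right; rewrite subrr !raddf0. Qed.

Lemma addr1_neq0 (l : C) : l <> -1 -> l + 1 != 0.
Proof. by move=> h; rewrite addr_eq0; apply/eqP. Qed.

Lemma subr_neq0 (l m : C) : l <> m -> l - m != 0.
Proof. by move=> h; rewrite subr_eq0; apply/eqP. Qed.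

(** * Paths in the graph are degenerations *)

Lemma gamma_edge_degenerates A B :
  Gamma A B -> degenerates (struct_of A) (struct_of B).
Proof.
case=> aA [aB].
case: A aA => [|||l||l||||l||||l m|l|] aA;
case: B aB => [|||n||n||||n||||n p|n|] aB // e;
  try exact: degenerates_C5; rewrite /= in aA aB e; (try by case: e); subst.
- exact: degenerates_02_01.
- exact: degenerates_02_03.
- exact/degenerates_03_01/addr1_neq0.
- exact: degenerates_04_05.
- exact: degenerates_04_06.
- exact: degenerates_05_02.
- by case: e => -> ->; exact: degenerates_05_03.
- by case: e => l1 l2; apply: degenerates_05_06; [exact: subr_neq0 | exact: addr1_neq0].
- exact: degenerates_06_02.
- exact: degenerates_06_03.
- exact: degenerates_07_05.
- exact: degenerates_07_06.
- exact: degenerates_08_10.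
- exact: degenerates_08_12.
- exact: degenerates_09_07.
- by case: aA => _ [l1 _]; apply: degenerates_09_10; [exact: subr_neq0 | exact: addr1_neq0].
- by case: e => -> ->; exact: degenerates_09_13.
- exact: degenerates_10_04.
- exact: degenerates_10_05.
- exact: degenerates_10_07.
- exact: degenerates_11_09.
- exact: degenerates_11_10.
- exact: degenerates_12_04.
- exact: degenerates_12_14.
- by case: e => -> [-> ->]; exact: degenerates_13_03.
- by case: e => -> l1; apply/degenerates_13_04/addr1_neq0.
- by case: e => -> [-> l1]; apply/degenerates_13_05/addr1_neq0.
- case: aA => [hl [hm _]]; case: e => [l1 [m1 lm]].
  have lm' : l <> m by move=> lm'; apply: lm.
  apply: degenerates_13_10; rewrite ?addr1_neq0 ?subr_neq0 // => e.
  by apply/lm'/disc_inv.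
- by case: e => -> ->; exact: degenerates_14_05.
- exact/degenerates_14_10/addr1_neq0.
- by case: e => [[-> [-> ->]]|[_ [-> ->]]]; exact: degenerates_14_13.
- exact: degenerates_15_10.
- by case: e => -> ->; exact: degenerates_15_13.
Qed.

Lemma gamma_path_degenerates A B :
  gamma_path A B -> degenerates (struct_of A) (struct_of B).
Proof.
elim=> [x y|x|x y z _ h1 _ h2].
- exact: gamma_edge_degenerates.
- exact: degenerates_refl.
- exact: degenerates_trans h1 h2.
Qed.

(** * Minors and their stable relations *)

(** The Cauchy-Binet formula before terms are collected: each row of the product is a combination of
    the rows of [B]. Summing over all maps, not over subsets, avoids orderings and signs; maps that
    are not injective contribute 0. *)
Lemma det_mulmx_row_choice (R : comPzRingType) k n
    (A : 'M[R]_(k, n)) (B : 'M[R]_(n, k)) :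
  \det (A *m B) =
  \sum_(f : {ffun 'I_k -> 'I_n}) (\prod_i A i (f i)) * \det (rowsub f B).
Proof.
rewrite /determinant; under eq_bigr => s _.
  under eq_bigr => i _ do rewrite mxE.
  rewrite bigA_distr_bigA big_distrr /=; over.
rewrite exchange_big /=; apply: eq_bigr => f _.
rewrite big_distrr /=; apply: eq_bigr => s _.
rewrite mulrCA; congr (_ * _); rewrite -big_split /=.
by apply: eq_bigr => i _; rewrite !mxE.
Qed.

(** What matters is that the coefficients depend on [h], [f], [g] but not on [N]. *)
Lemma minor_congr (h N : 'M[C]_5) k (f g : 'I_k -> 'I_5) :
  \det (mxsub f g (h^T *m N *m h)) =
  \sum_(a : {ffun 'I_k -> 'I_5}) \sum_(b : {ffun 'I_k -> 'I_5})
    (\prod_i h (a i) (f i)) * (\prod_i h (b i) (g i)) * \det (mxsub a b N).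
Proof.
have -> : mxsub f g (h^T *m N *m h) = rowsub f h^T *m (N *m colsub g h).
  by apply/matrixP=> i j; rewrite -mulmxA !mxE; apply: eq_bigr => c _; rewrite !mxE;
     congr (_ * _); apply: eq_bigr => d _; rewrite !mxE.
rewrite det_mulmx_row_choice; apply: eq_bigr => a _.
have -> : \det (rowsub a (N *m colsub g h)) =
    \det ((colsub g h)^T *m (rowsub a N)^T).
  by rewrite -trmx_mul det_tr; congr (\det _); apply/matrixP=> i j; rewrite !mxE;
     apply: eq_bigr => c _; rewrite !mxE.
rewrite det_mulmx_row_choice big_distrr /=; apply: eq_bigr => b _.
rewrite -[\det (rowsub b _)]det_tr mulrA; congr (_ * _ * _).
- by apply: eq_bigr => i _; rewrite !mxE.
- by apply: eq_bigr => i _; rewrite !mxE.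
- by congr (\det _); apply/matrixP=> i j; rewrite !mxE.
Qed.

Definition pencil (M : 'M[C]_5) (p : C * C) : 'M[C]_5 := p.1 *: M + p.2 *: M^T.

(** An item of [L] is a coefficient with a point of the pencil. All index maps are allowed, to match
    the sums in [minor_congr]. *)
Definition minor_relation k (L : seq (C * (C * C))) (M : 'M[C]_5) : Prop :=
  forall f g : 'I_k -> 'I_5,
    \sum_(t <- L) t.1 * \det (mxsub f g (pencil M t.2)) = 0.

Lemma minor_relation_congr k L (h M : 'M[C]_5) c :
  minor_relation k L M -> minor_relation k L (c *: (h^T *m M *m h)).
Proof.
move=> hM f g.
have pE p : pencil (c *: (h^T *m M *m h)) p = c *: (h^T *m pencil M p *m h).
  have -> : pencil (c *: (h^T *m M *m h)) p =
      p.1 *: (c *: (h^T *m M *m h)) + p.2 *: (c *: (h^T *m M^T *m h)).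
    by rewrite /pencil [(c *: _)^T]linearZ /= !trmx_mul trmxK mulmxA.
  rewrite /pencil mulmxDr mulmxDl.
  by rewrite -!scalemxAr -!scalemxAl scalerDr !scalerA ![c * _]mulrC.
under eq_bigr => t _.
  rewrite pE (_ : mxsub f g _ = c *: mxsub f g (h^T *m pencil M t.2 *m h)); last first.
    by apply/matrixP=> i j; rewrite !mxE.
  rewrite detZ minor_congr mulrCA !big_distrr /=.
  under eq_bigr => a _ do rewrite big_distrr big_distrr /=.
  over.
rewrite exchange_big big1 //= => a _; rewrite exchange_big big1 //= => b _.
under eq_bigr => t _ do rewrite [t.1 * _]mulrCA mulrA.
by rewrite -big_distrr /= hM mulr0.
Qed.

Lemma minor_relation_degenerates k L (M M' : 'M[C]_5) :
  degenerates (heis_of_mx M) (heis_of_mx M') -> minor_relation k L M -> minor_relation k L M'.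
Proof.
move=> dM hM f g.
pose X : 'M[{mpoly C[125]}]_5 := \matrix_(i, j) 'X_(coord_index i j ord_max).
pose p := \sum_(t <- L) t.1 *:
  \det (mxsub f g ((t.2.1)%:MP *: X + (t.2.2)%:MP *: X^T)).
have pE mu : p.@[coords mu] =
    \sum_(t <- L) t.1 * \det (mxsub f g (pencil (slice mu ord_max) t.2)).
  rewrite /p raddf_sum; apply: eq_bigr => t _; rewrite /= mevalZ; congr (_ * _).
  rewrite -[meval _]/(meval (coords mu)) -det_map_mx map_mxsub; congr (\det (mxsub _ _ _)).
  by apply/matrixP=> i j; rewrite !mxE /= mevalD !mevalM !mevalC !mevalXU !coords_index.
have sliceE N : slice (heis_of_mx N) ord_max = N by apply/matrixP=> i j; rewrite mxE.
rewrite -(sliceE M') -pE; apply: dM => _ [g0 [ug ->]]; rewrite pE.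
have -> : slice (gl_act g0 (heis_of_mx M)) ord_max =
    g0 ord_max ord_max *: ((invmx g0)^T *m M *m invmx g0).
  by apply/matrixP=> i j; rewrite mxE gl_act_hs [RHS]mxE.
exact: minor_relation_congr.
Qed.

(** * Small determinants in computable form *)

(** Row indices come first, then column indices. Entries indexed by [nat] unfold on literals, so
    that [ring] can evaluate minors of concrete forms. *)
Definition det2 (R : pzRingType) (F : nat -> nat -> R) a b c d : R :=
  F a c * F b d - F a d * F b c.

Definition det3 (R : pzRingType) (F : nat -> nat -> R) a b c d e f : R :=
  F a d * det2 F b c e f - F a e * det2 F b c d f + F a f * det2 F b c d e.

Definition det4 (R : pzRingType) (F : nat -> nat -> R) a b c d e f g h : R :=
  F a e * det3 F b c d f g h - F a f * det3 F b c d e g h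
  + F a g * det3 F b c d e f h - F a h * det3 F b c d e f g.

Lemma det_matrixS (R : comPzRingType) k (F : nat -> nat -> R) :
  \det (\matrix_(i < k.+1, j < k.+1) F i j) =
  \sum_(j < k.+1) F 0%N j * ((-1) ^+ j *
     \det (\matrix_(a < k, b < k) F a.+1 (bump j b))).
Proof.
rewrite (expand_det_row _ ord0); apply: eq_bigr => j _.
rewrite mxE /cofactor add0n; congr (_ * (_ * \det _)).
by apply/matrixP=> a b; rewrite !mxE.
Qed.

Lemma det_matrix2 (R : comPzRingType) (F : nat -> nat -> R) :
  \det (\matrix_(i < 2, j < 2) F i j) = det2 F 0 1 0 1.
Proof.
by rewrite det_matrixS !big_ord_recl big_ord0 !det_mx11 !mxE /= /det2; ring.
Qed.

Lemma det_matrix3 (R : comPzRingType) (F : nat -> nat -> R) :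
  \det (\matrix_(i < 3, j < 3) F i j) = det3 F 0 1 2 0 1 2.
Proof.
rewrite det_matrixS !big_ord_recl big_ord0.
rewrite (det_matrix2 (fun a b => F a.+1 (bump _ b))).
rewrite (det_matrix2 (fun a b => F a.+1 (bump (lift ord0 ord0) b))).
rewrite (det_matrix2 (fun a b => F a.+1 (bump (lift ord0 (lift ord0 ord0)) b))).
by rewrite /det3 /det2 /bump /=; ring.
Qed.

Lemma det_matrix4 (R : comPzRingType) (F : nat -> nat -> R) :
  \det (\matrix_(i < 4, j < 4) F i j) = det4 F 0 1 2 3 0 1 2 3.
Proof.
rewrite det_matrixS !big_ord_recl big_ord0.
rewrite (det_matrix3 (fun a b => F a.+1 (bump ord0 b))).
rewrite (det_matrix3 (fun a b => F a.+1 (bump (lift ord0 ord0) b))).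
rewrite (det_matrix3 (fun a b => F a.+1 (bump (lift ord0 (lift ord0 ord0)) b))).
rewrite (det_matrix3
  (fun a b => F a.+1 (bump (lift ord0 (lift ord0 (lift ord0 ord0))) b))).
by rewrite /det4 /det3 /det2 /bump /=; ring.
Qed.

(** * Rank and determinant obstructions *)

Definition pen (s : seq (nat * nat * C)) (p : C * C) (i j : nat) : C :=
  p.1 * entry s i j + p.2 * entry s j i.

Lemma pencil_form s p (i j : 'I_5) : pencil (form s) p i j = pen s p i j.
Proof. by rewrite /pen !entryE !mxE. Qed.

Lemma minor_pen s p k (r c : nat -> nat) :
  (forall i, i < k -> r i < 5)%N -> (forall i, i < k -> c i < 5)%N ->
  \det (mxsub (fun i : 'I_k => inord (r i) : 'I_5) (fun i => inord (c i))
              (pencil (form s) p)) =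
  \det (\matrix_(i < k, j < k) pen s p (r i) (c j)).
Proof.
move=> hr hc; congr (\det _); apply/matrixP=> i j.
by rewrite [LHS]mxE [RHS]mxE pencil_form !inordK ?hr ?hc.
Qed.

(** The member has fewer than [k] nonzero rows, so any choice of [k] rows contains a zero row or a
    repeated one. All its [k]-minors vanish, and this persists in the limit. *)
Lemma few_rows_obstruction k (w : seq nat) s s' p (r c : nat -> nat) :
  degenerates (heis s) (heis s') -> (size w < k)%N ->
  (forall i j, (i < 5)%N -> (j < 5)%N -> i \notin w -> pen s p i j = 0) ->
  (forall i, i < k -> r i < 5)%N -> (forall i, i < k -> c i < 5)%N ->
  \det (\matrix_(i < k, j < k) pen s' p (r i) (c j)) = 0.
Proof.
move=> + wk hw hr hc; rewrite !heisE => dg.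
have : minor_relation k [:: (1, p)] (form s).
  move=> f g; rewrite big_seq1 mul1r /=.
  have [fw|/forallPn[i fi]] := boolP [forall i, nat_of_ord (f i) \in w]; last first.
    rewrite (expand_det_row _ i) big1 // => j _.
    by rewrite mxE pencil_form hw ?mul0r.
  have /injectivePn[i [j ij fij]] : ~~ injectiveb f.
    apply/negP=> /injectiveP fi.
    have := @uniq_leq_size _ [seq nat_of_ord (f i) | i <- enum 'I_k] w.
    rewrite map_inj_uniq ?enum_uniq; last by move=> x y /val_inj /fi.
    rewrite size_map size_enum_ord leqNgt wk /= => h.
    suff : false by []; apply: (h isT) => _ /mapP[x _ ->].
    exact: (forallP fw).
  by apply: (determinant_alternate ij) => x; rewrite !mxE fij.
move/(minor_relation_degenerates dg) => /(_ (fun i => inord (r i)) (fun i => inord (c i))).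
by rewrite big_seq1 mul1r /= minor_pen.
Qed.

Definition supported k (s : seq (nat * nat * C)) :=
  all (fun t => (t.1.1 <= k)%N && (t.1.2 <= k)%N) s.

Lemma entry_supported k s i j : supported k s -> (k <= maxn i j)%N ->
  entry s i j = 0.
Proof.
move=> + mij; elim: s => //= t s IH /andP[/andP[h1 h2]] /IH->.
case: ifP => // /andP[/eqP e1 /eqP e2]; rewrite e1 e2 in h1 h2.
by rewrite leqNgt gtn_max h1 h2 in mij.
Qed.

(** The leading block is multiplied on both sides by selection matrices, which do not depend on [p];
    an index outside the support selects a zero row or column. *)
Lemma supported_minor k s p (f g : 'I_k -> 'I_5) : supported k s -> (k <= 5)%N ->
  \det (mxsub f g (pencil (form s) p)) =
  \det (\matrix_(i < k, j < k) (j == f i :> nat)%:R) *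
  \det (\matrix_(i < k, j < k) pen s p i j) *
  \det (\matrix_(i < k, j < k) (i == g j :> nat)%:R).
Proof.
move=> sk k5; rewrite -!det_mulmx; congr (\det _); apply/matrixP=> i j.
have pick (n : 'I_5) (x : 'I_k -> C) (y : nat -> C) :
    (forall a, x a = y a) -> ((k <= n)%N -> y n = 0) ->
    \sum_(a < k) (a == n :> nat)%:R * x a = y n.
  move=> xy yn; have [nk|kn] := ltnP n k.
    rewrite (bigD1 (Ordinal nk)) //= eqxx mul1r xy big1 ?addr0 // => a.
    by rewrite -val_eqE /= => /negPf->; rewrite mul0r.
  rewrite yn // big1 // => a _; rewrite (_ : _ == _ = false) ?mul0r //.
  by apply/eqP=> an; have := ltn_ord a; rewrite an ltnNge kn.
have pen0 a b : (k <= maxn a b)%N -> pen s p a b = 0.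
  by move=> h; rewrite /pen !(entry_supported sk) // ?mulr0 ?addr0 // maxnC.
rewrite mxE pencil_form [RHS]mxE.
under eq_bigr => b _ do rewrite mulrC [X in X * _]mxE.
rewrite (@pick (g j) _ (fun b => pen s p (f i) b)) //.
  move=> b; rewrite mxE; under eq_bigr => a _ do rewrite !mxE.
  rewrite (@pick (f i) _ (fun a => pen s p a b)) // => kf.
  by rewrite pen0 // leq_max kf.
by move=> kg; rewrite pen0 // leq_max kg orbT.
Qed.

Lemma det_obstruction k s s' p q (r c : nat -> nat) :
  degenerates (heis s) (heis s') -> supported k s -> (k <= 5)%N ->
  (forall i, i < k -> r i < 5)%N -> (forall i, i < k -> c i < 5)%N ->
  \det (\matrix_(i < k, j < k) pen s q i j) *
  \det (\matrix_(i < k, j < k) pen s' p (r i) (c j)) =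
  \det (\matrix_(i < k, j < k) pen s p i j) *
  \det (\matrix_(i < k, j < k) pen s' q (r i) (c j)).
Proof.
rewrite !heisE => dg sk k5 hr hc; apply/eqP; rewrite -subr_eq0; apply/eqP.
set dp := \det (\matrix_(i, j) pen s p i j).
set dq := \det (\matrix_(i, j) pen s q i j).
(* By [supported_minor] each minor is the leading one times a factor common to [p] and [q], so this
   combination cancels. *)
have : minor_relation k [:: (dq, p); (- dp, q)] (form s).
  move=> f g; rewrite big_cons big_seq1 /= !supported_minor // -/dp -/dq; ring.
move/(minor_relation_degenerates dg) => /(_ (fun i => inord (r i)) (fun i => inord (c i))).
by rewrite big_cons big_seq1 /= !minor_pen // mulNr.
Qed.

Lemma det0_obstruction k s s' p (r c : nat -> nat) :
  degenerates (heis s) (heis s') -> supported k s -> (k <= 5)%N ->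
  (forall i, i < k -> r i < 5)%N -> (forall i, i < k -> c i < 5)%N ->
  \det (\matrix_(i < k, j < k) pen s p i j) = 0 ->
  \det (\matrix_(i < k, j < k) pen s' p (r i) (c j)) = 0.
Proof.
rewrite !heisE => dg sk k5 hr hc dp0.
have : minor_relation k [:: (1, p)] (form s).
  by move=> f g; rewrite big_seq1 /= supported_minor // dp0 mulr0 mul0r mulr0.
move/(minor_relation_degenerates dg) => /(_ (fun i => inord (r i)) (fun i => inord (c i))).
by rewrite big_seq1 mul1r /= minor_pen.
Qed.

(** * Determinants of the pencils of the listed algebras *)

(** The multiplication tables as data: [struct_of] returns functions, from which the lists needed by
    [entry] cannot be recovered. *)
Definition seq_of (A : alg5) : seq (nat * nat * C) :=
  match A with
  | C5 => [::]
  | H01 => [:: (1, 1, 1)]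
  | H02 => [:: (1, 2, -1); (2, 1, 1); (2, 2, 1)]
  | H03 l => [:: (1, 2, 1); (2, 1, l)]
  | H04 => [:: (1, 1, 1); (2, 3, -1); (3, 2, 1); (3, 3, 1)]
  | H05 l => [:: (1, 1, 1); (2, 3, 1); (3, 2, l)]
  | H06 => [:: (1, 2, 1); (2, 3, 1)]
  | H07 => [:: (1, 3, 1); (2, 2, -1); (2, 3, -1); (3, 1, 1); (3, 2, 1)]
  | H08 => [:: (1, 4, -1); (2, 3, 1); (2, 4, 1); (3, 2, -1);
               (3, 3, -1); (4, 1, 1); (4, 2, 1)]
  | H09 l => [:: (1, 3, 1); (2, 4, 1); (3, 1, l); (3, 2, 1); (4, 2, l)]
  | H10 => [:: (1, 1, 1); (2, 3, 1); (3, 4, 1)]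
  | H11 => [:: (1, 1, 1); (2, 4, 1); (3, 3, -1); (3, 4, -1);
               (4, 2, 1); (4, 3, 1)]
  | H12 => [:: (1, 2, -1); (2, 1, 1); (2, 2, 1); (3, 4, -1);
               (4, 3, 1); (4, 4, 1)]
  | H13 l m => [:: (1, 2, 1); (2, 1, m); (3, 4, 1); (4, 3, l)]
  | H14 l => [:: (1, 2, 1); (2, 1, l); (3, 4, -1); (4, 3, 1); (4, 4, 1)]
  | H15 => [:: (1, 2, 1); (2, 3, 1); (3, 4, 1)]
  end.

Lemma struct_ofE A : struct_of A = heis (seq_of A).
Proof.
by case: A => //; apply: struct5P => i j k; rewrite /heis big_nil; case: ifP.
Qed.

(** Minus the determinant of the pencil of [H03 l]. Its zeros are the multiples of [(l, -1)] and
    [(-1, l)], so it determines [l] up to inversion. *)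
Definition quad (l : C) (p : C * C) : C := (p.1 + l * p.2) * (p.2 + l * p.1).

(** The parameters of the two factors [quad] in the determinant of the pencil, or [None] when the
    determinant is zero; [cls3] and [cls2] do the same in sizes 3 and 2. *)
Definition cls4 (A : alg5) : option (C * C) :=
  match A with
  | H08 | H12 => Some (-1, -1)
  | H09 l => Some (l, l)
  | H11 => Some (1, 1)
  | H13 l m => Some (l, m)
  | H14 l => Some (l, -1)
  | H15 => Some (0, 0)
  | _ => None
  end.

Definition cls3 (A : alg5) : option C :=
  match A with
  | H04 => Some (-1) | H05 l => Some l | H07 => Some 1 | _ => None
  end.

Definition cls2 (A : alg5) : option C :=
  match A with H02 => Some (-1) | H03 l => Some l | _ => None end.

Lemma det4_pen A p : det4 (pen (seq_of A) p) 0 1 2 3 0 1 2 3 =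
  if cls4 A is Some (l, m) then quad l p * quad m p else 0.
Proof.
by case: A => [|||l||l||||l||||l m|l|];
   rewrite /det4 /det3 /det2 /pen /quad /=; ring.
Qed.

(** The factor [p.1 + p.2] is forced: at [(1, -1)] the member is skew of odd size. *)
Lemma det3_pen A : supported 3 (seq_of A) ->
  exists2 c : C, c != 0 & forall p, det3 (pen (seq_of A) p) 0 1 2 0 1 2 =
  if cls3 A is Some l then c * ((p.1 + p.2) * quad l p) else 0.
Proof.
move=> A3; exists (if A is H07 then 1 else -1).
  by case: A A3; rewrite ?oppr_eq0 oner_neq0.
move: A3; case: A => [|||l||l||||l||||l m|l|] // _ p;
  by rewrite /det3 /det2 /pen /quad /=; ring.
Qed.

Lemma det2_pen A p : supported 2 (seq_of A) ->
  det2 (pen (seq_of A) p) 0 1 0 1 =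
  if cls2 A is Some l then - quad l p else 0.
Proof.
by case: A => [|||l||l||||l||||l m|l|] // _;
   rewrite /det2 /pen /quad /=; ring.
Qed.

Lemma quad_self (l : C) : quad l (l, -1) = 0.
Proof. by rewrite /quad /=; ring. Qed.

Lemma quad_root (l m : C) : in_unit_disc_half l -> in_unit_disc_half m ->
  quad m (l, -1) = 0 -> l = m.
Proof.
move=> hl hm /eqP; rewrite /quad /= mulf_eq0 => /orP[] /eqP e.
  by apply/eqP; rewrite -subr_eq0 -e; apply/eqP; ring.
apply: disc_inv => //; apply/eqP; rewrite -subr_eq0 -e; apply/eqP; ring.
Qed.

Lemma avoid_seq (s : seq C) : exists z, forall x, x \in s -> z + x != 0.
Proof.
exists (1 + \sum_(x <- s) `|x|) => x xs; rewrite addr_eq0.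
apply: contraTneq isT => e; have : `|x| < `|- x|.
  have s0 : 0 <= \sum_(x <- s) `|x| by rewrite sumr_ge0.
  rewrite -e (ger0_norm (addr_ge0 ler01 s0)) (big_rem x xs) /= addrCA ltrDl.
  by rewrite ltr_pwDl // sumr_ge0.
by rewrite normrN ltxx.
Qed.

Lemma quad_nonroot (l m : C) :
  exists p : C * C, [/\ quad l p != 0, quad m p != 0 & p.1 + p.2 != 0].
Proof.
have [z hz] := avoid_seq [:: 1; l; m; l^-1; m^-1].
have quad0 x : z + x != 0 -> z + x^-1 != 0 -> quad x (1, z) != 0.
  move=> h1 h2; rewrite mulf_neq0 //=; last by rewrite mulr1.
  have [->|x0] := eqVneq x 0; first by rewrite mul0r addr0 oner_neq0.
  have -> : 1 + x * z = x * (z + x^-1) by field.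
  by rewrite mulf_neq0.
exists (1, z); split; last by rewrite /= addrC hz // !inE eqxx.
- by apply: quad0; rewrite hz // !inE eqxx ?orbT.
- by apply: quad0; rewrite hz // !inE eqxx ?orbT.
Qed.

Lemma cls4_admissible A l m : admissible A -> cls4 A = Some (l, m) ->
  in_unit_disc_half l /\ in_unit_disc_half m.
Proof.
have := (disc0, disc1, discN1) => -[[d0 d1] dN1].
case: A => [|||k||k||||k||||k n|k|] //= a [<- <-] //; first by case: a.
by case: a => ? [].
Qed.

(** The two determinants are proportional and that of [B] is not zero, so they have the same zeros;
    testing at the points [(l, -1)] compares the parameters. The conclusion states equality of sets,
    which for pairs is equality with multiplicities. *)
Lemma cls4_degenerates A B l' m' : admissible A -> admissible B ->
  degenerates (struct_of A) (struct_of B) -> cls4 B = Some (l', m') ->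
  exists l m, [/\ cls4 A = Some (l, m), l = l' \/ l = m', m = l' \/ m = m',
                  l' = l \/ l' = m & m' = l \/ m' = m].
Proof.
move=> aA aB; rewrite !struct_ofE => dg eB.
have [dl' dm'] := cls4_admissible aB eB.
have A4 : supported 4 (seq_of A) by case: (A).
have lt5 i : (i < 4 -> i < 5)%N by apply: ltnW.
have obs0 p : (if cls4 A is Some (l, m) then quad l p * quad m p else 0) = 0 ->
    quad l' p * quad m' p = 0.
  have := @det0_obstruction 4 _ _ p (fun i => i) (fun i => i) dg A4 isT lt5 lt5.
  by rewrite !det_matrix4 !det4_pen eB.
have [q [ql qm _]] := quad_nonroot l' m'.
have quadBq : quad l' q * quad m' q != 0 by rewrite mulf_neq0.
case eA : (cls4 A) obs0 => [[l m]|] obs0; last by rewrite obs0 ?eqxx in quadBq.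
have [dl dm] := cls4_admissible aA eA.
have obs p : quad l' p * quad m' p = 0 -> quad l p * quad m p = 0.
  have := @det_obstruction 4 _ _ p q (fun i => i) (fun i => i) dg A4 isT lt5 lt5.
  rewrite !det_matrix4 !det4_pen eA eB => + e; rewrite e mulr0 => /esym/eqP.
  by rewrite mulf_eq0 (negPf quadBq) orbF => /eqP.
have root a b c : in_unit_disc_half a -> in_unit_disc_half b ->
    in_unit_disc_half c -> quad b (a, -1) * quad c (a, -1) = 0 ->
    a = b \/ a = c.
  move=> da db dc /eqP; rewrite mulf_eq0.
  by case/orP=> /eqP h; [left | right]; apply: quad_root.
exists l, m; split=> //; apply: root => //; (apply: obs || apply: obs0);
  by rewrite quad_self ?mul0r ?mulr0.
Qed.

Lemma cls3_degenerates A B l' : admissible A -> admissible B ->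
  degenerates (struct_of A) (struct_of B) ->
  supported 3 (seq_of A) -> supported 3 (seq_of B) ->
  cls3 B = Some l' -> cls3 A = Some l'.
Proof.
have disc3 D l : admissible D -> cls3 D = Some l -> in_unit_disc_half l.
  have := (disc1, discN1) => -[d1 dN1].
  by case: D => [|||k||k||||k||||k n|k|] //= a [<-].
move=> aA aB; rewrite !struct_ofE => dg A3 B3 eB.
have dl' := disc3 _ _ aB eB.
have lt5 i : (i < 3 -> i < 5)%N by move=> h; rewrite (ltn_trans h).
have [a a0 detA] := det3_pen A3; have [b b0 detB] := det3_pen B3.
have obs0 p : (if cls3 A is Some l then a * ((p.1 + p.2) * quad l p) else 0) = 0 ->
    b * ((p.1 + p.2) * quad l' p) = 0.
  have := @det0_obstruction 3 _ _ p (fun i => i) (fun i => i) dg A3 isT lt5 lt5.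
  by rewrite !det_matrix3 detA detB eB.
have [q [ql _ q1]] := quad_nonroot l' 0.
have quadBq : b * ((q.1 + q.2) * quad l' q) != 0 by apply: mulf_neq0 => //; apply: mulf_neq0.
case eA : (cls3 A) obs0 => [l|] obs0; last by rewrite obs0 ?eqxx in quadBq.
have dl := disc3 _ _ aA eA.
have obs p : b * ((p.1 + p.2) * quad l' p) = 0 ->
    a * ((p.1 + p.2) * quad l p) = 0.
  have := @det_obstruction 3 _ _ p q (fun i => i) (fun i => i) dg A3 isT lt5 lt5.
  rewrite !det_matrix3 !detA !detB eA eB => + e; rewrite e mulr0 => /esym/eqP.
  by rewrite mulf_eq0 (negPf quadBq) orbF => /eqP.
have root c x y : c != 0 -> in_unit_disc_half x -> in_unit_disc_half y ->
    c * ((x - 1) * quad y (x, -1)) = 0 -> x = 1 \/ x = y.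
  move=> c0 dx dy /eqP; rewrite mulf_eq0 (negPf c0) mulf_eq0 subr_eq0 /=.
  by case/orP=> /eqP h; [left | right] => //; apply: quad_root.
congr Some.
(* At [l = 1] the factor [x + y] already vanishes at [(l, -1)] and hides [l'], so this case also
   needs the converse inclusion of zeros. *)
case: (root b l l' b0 dl dl'); first by apply: (obs0 (l, -1)); rewrite quad_self !mulr0.
  move=> l1; case: (root a l' l a0 dl' dl) => [|l1'|//].
    by apply: (obs (l', -1)); rewrite quad_self !mulr0.
  by rewrite l1 l1'.
by [].
Qed.

Lemma cls2_degenerates A B l' : admissible A -> admissible B ->
  degenerates (struct_of A) (struct_of B) ->
  supported 2 (seq_of A) -> supported 2 (seq_of B) ->
  cls2 B = Some l' -> cls2 A = Some l'.
Proof.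
have disc2 D l : admissible D -> cls2 D = Some l -> in_unit_disc_half l.
  have dN1 := discN1.
  by case: D => [|||k||k||||k||||k n|k|] //= a [<-].
move=> aA aB; rewrite !struct_ofE => dg A2 B2 eB.
have lt5 i : (i < 2 -> i < 5)%N by move=> h; rewrite (ltn_trans h).
have obs0 p : (if cls2 A is Some l then - quad l p else 0) = 0 -> quad l' p = 0.
  have := @det0_obstruction 2 _ _ p (fun i => i) (fun i => i) dg A2 isT lt5 lt5.
  rewrite !det_matrix2 !det2_pen // eB => h /h /eqP.
  by rewrite oppr_eq0 => /eqP.
case eA : (cls2 A) obs0 => [l|] obs0.
  congr Some; apply: quad_root; [exact: disc2 aA eA | exact: disc2 aB eB |].
  by apply: obs0; rewrite quad_self oppr0.
have [q [ql _ _]] := quad_nonroot l' 0.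
by rewrite obs0 ?eqxx in ql.
Qed.

(** * Rank bounds for special members of the pencils *)

Lemma rank0_obstruction A B p i j :
  degenerates (struct_of A) (struct_of B) ->
  (forall a b, (a < 5)%N -> (b < 5)%N -> a \notin (@nil nat) ->
     pen (seq_of A) p a b = 0) ->
  (i < 5)%N -> (j < 5)%N -> pen (seq_of B) p i j = 0.
Proof.
rewrite !struct_ofE => dg hA hi hj.
have := @few_rows_obstruction 1 [::] _ _ p (fun=> i) (fun=> j) dg isT hA.
by rewrite det_mx11 mxE; apply.
Qed.

Lemma rank1_obstruction w A B p a b c d :
  degenerates (struct_of A) (struct_of B) ->
  (forall i j, (i < 5)%N -> (j < 5)%N -> i \notin [:: w] ->
     pen (seq_of A) p i j = 0) ->
  all (gtn 5) [:: a; b; c; d] -> det2 (pen (seq_of B) p) a b c d = 0.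
Proof.
rewrite !struct_ofE => dg hA /= /and5P[ha hb hc hd _].
have := @few_rows_obstruction 2 [:: w] _ _ p (nth 0 [:: a; b]%N) (nth 0 [:: c; d]%N) dg isT hA.
rewrite (det_matrix2 (fun i j => pen (seq_of B) p (nth 0 [:: a; b]%N i) (nth 0 [:: c; d]%N j))).
by apply; case=> [|[|i]].
Qed.

Lemma rank2_obstruction v w A B p a b c d e f :
  degenerates (struct_of A) (struct_of B) ->
  (forall i j, (i < 5)%N -> (j < 5)%N -> i \notin [:: v; w] ->
     pen (seq_of A) p i j = 0) ->
  all (gtn 5) [:: a; b; c; d; e; f] -> det3 (pen (seq_of B) p) a b c d e f = 0.
Proof.
rewrite !struct_ofE => dg hA /= /and5P[ha hb hc hd /and3P[he hf _]].
have := @few_rows_obstruction 3 [:: v; w] _ _ p (nth 0 [:: a; b; c]%N) (nth 0 [:: d; e; f]%N) dg isT hA.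
rewrite (det_matrix3 (fun i j => pen (seq_of B) p (nth 0 [:: a; b; c]%N i) (nth 0 [:: d; e; f]%N j))).
by apply; case=> [|[|[|i]]].
Qed.

Ltac zero_rows :=
  move=> [|[|[|[|[|?]]]]] [|[|[|[|[|?]]]]] // _ _ _; rewrite /pen /=; ring.

Lemma H05_sym_obstruction B i j :
  degenerates (struct_of (H05 1)) (struct_of B) ->
  (i < 5)%N -> (j < 5)%N -> pen (seq_of B) (1, -1) i j = 0.
Proof. by move=> dg; apply: rank0_obstruction dg _; zero_rows. Qed.

Lemma H13_sym_obstruction B i j :
  degenerates (struct_of (H13 1 1)) (struct_of B) ->
  (i < 5)%N -> (j < 5)%N -> pen (seq_of B) (1, -1) i j = 0.
Proof. by move=> dg; apply: rank0_obstruction dg _; zero_rows. Qed.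

Lemma H03_skew_obstruction B i j :
  degenerates (struct_of (H03 (-1))) (struct_of B) ->
  (i < 5)%N -> (j < 5)%N -> pen (seq_of B) (1, 1) i j = 0.
Proof. by move=> dg; apply: rank0_obstruction dg _; zero_rows. Qed.

Lemma H13_skew_obstruction B i j :
  degenerates (struct_of (H13 (-1) (-1))) (struct_of B) ->
  (i < 5)%N -> (j < 5)%N -> pen (seq_of B) (1, 1) i j = 0.
Proof. by move=> dg; apply: rank0_obstruction dg _; zero_rows. Qed.

Lemma C5_obstruction B p i j :
  degenerates (struct_of C5) (struct_of B) ->
  (i < 5)%N -> (j < 5)%N -> pen (seq_of B) p i j = 0.
Proof. by move=> dg; apply: rank0_obstruction dg _; zero_rows. Qed.

Lemma H05_symrank_obstruction B a b c d :
  degenerates (struct_of (H05 (-1))) (struct_of B) ->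
  all (gtn 5) [:: a; b; c; d] -> det2 (pen (seq_of B) (1, 1)) a b c d = 0.
Proof. by move=> dg; apply: (@rank1_obstruction 0 _ _ _ _ _ _ _ dg); zero_rows. Qed.

Lemma H14_symrank_obstruction B a b c d :
  degenerates (struct_of (H14 (-1))) (struct_of B) ->
  all (gtn 5) [:: a; b; c; d] -> det2 (pen (seq_of B) (1, 1)) a b c d = 0.
Proof. by move=> dg; apply: (@rank1_obstruction 3 _ _ _ _ _ _ _ dg); zero_rows. Qed.

Lemma H12_symrank_obstruction B a b c d e f :
  degenerates (struct_of H12) (struct_of B) ->
  all (gtn 5) [:: a; b; c; d; e; f] ->
  det3 (pen (seq_of B) (1, 1)) a b c d e f = 0.
Proof. by move=> dg; apply: (@rank2_obstruction 1 3 _ _ _ _ _ _ _ _ _ dg); zero_rows. Qed.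

Lemma H13_symrank_obstruction l B a b c d e f :
  degenerates (struct_of (H13 l (-1))) (struct_of B) ->
  all (gtn 5) [:: a; b; c; d; e; f] ->
  det3 (pen (seq_of B) (1, 1)) a b c d e f = 0.
Proof. by move=> dg; apply: (@rank2_obstruction 2 3 _ _ _ _ _ _ _ _ _ dg); zero_rows. Qed.

(** At the root [(l, -1)] each of the two uncoupled blocks keeps at most one nonzero row. *)
Lemma H13_eigen_obstruction l B a b c d e f :
  degenerates (struct_of (H13 l l)) (struct_of B) ->
  all (gtn 5) [:: a; b; c; d; e; f] ->
  det3 (pen (seq_of B) (l, -1)) a b c d e f = 0.
Proof. by move=> dg; apply: (@rank2_obstruction 1 3 _ _ _ _ _ _ _ _ _ dg); zero_rows. Qed.

(** * The cubic relation for [H09 1] *)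

(** The matrix of [H09 1] over the integers, where computation decides the relation. *)
Definition H09_int (i j : nat) : int :=
  ((i, j) \in [:: (0, 2); (1, 3); (2, 0); (2, 1); (3, 1)]%N)%:Z.

(** Let [M = S + K] with [S] symmetric and [K] skew, and let [p], [q] be the coefficients of [x^3]
    and [x y^2] in a 3-minor of [x S + y K]. The left side is [8 (p + q)] and the right side [8 p],
    so the relation says [q = 0]. *)
Definition H09_relation a b c d e f : bool :=
  4 * det3 H09_int a b c d e f + 4 * det3 (fun i j => H09_int j i) a b c d e f
  == det3 (fun i j => H09_int i j + H09_int j i) a b c d e f.

Lemma H09_relation_sorted : all (fun a => all (fun b => all (fun c =>
  if (a < b < c)%N then all (fun d => all (fun e => all (fun f =>
    if (d < e < f)%N then H09_relation a b c d e f else true)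
    (iota 0 5)) (iota 0 5)) (iota 0 5) else true)
  (iota 0 5)) (iota 0 5)) (iota 0 5).
Proof. by vm_compute. Qed.

Lemma sort3_ind (P : nat -> nat -> nat -> Prop) :
  (forall a b c, P b a c -> P a b c) -> (forall a b c, P a c b -> P a b c) ->
  (forall a b, P a a b) -> (forall a b c, (a < b < c)%N -> P a b c) ->
  forall a b c, P a b c.
Proof.
move=> s12 s23 eq12 lt a b c.
have eq23 x y : P x y y by apply/s12/s23.
have inc x y z : (x < y)%N -> P x y z.
  move=> xy; have [zy|yz|<-] := ltngtP z y; last exact: eq23.
    apply: s23; have [xz|zx|<-] := ltngtP x z; last exact: eq12.
      by apply: lt; rewrite xz.
    by apply: s12; apply: lt; rewrite zx.
  by apply: lt; rewrite xy.
have [ab|ba|->] := ltngtP a b; last exact: eq12.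
  exact: inc.
by apply/s12/inc.
Qed.

(** Both sides are alternating in the rows and in the columns, so increasing triples suffice, that
    is 100 minors. *)
Lemma H09_relation_all a b c d e f : all (gtn 5) [:: a; b; c; d; e; f] ->
  H09_relation a b c d e f.
Proof.
have rowswap (F : nat -> nat -> int) i j k x y z :
    det3 F i j k x y z = - det3 F j i k x y z /\
    det3 F i j k x y z = - det3 F i k j x y z /\ det3 F i i k x y z = 0.
  by rewrite /det3 /det2; split; [|split]; ring.
have colswap (F : nat -> nat -> int) i j k x y z :
    det3 F i j k x y z = - det3 F i j k y x z /\
    det3 F i j k x y z = - det3 F i j k x z y /\ det3 F i j k x x z = 0.
  by rewrite /det3 /det2; split; [|split]; ring.
have rel_opp (p q r p' q' r' : int) : p = - p' -> q = - q' -> r = - r' ->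
    4 * p' + 4 * q' == r' -> 4 * p + 4 * q == r.
  by move=> -> -> -> /eqP <-; apply/eqP; ring.
move: a b c; apply: (@sort3_ind (fun a b c => all (gtn 5) [:: a; b; c; d; e; f] ->
  H09_relation a b c d e f)).
- move=> a b c IH h; apply: rel_opp (IH _); try apply: (rowswap _ _ _ _ _ _ _).1.
  by move: h => /= /and4P[-> -> ->].
- move=> a b c IH h; apply: rel_opp (IH _); try apply: (rowswap _ _ _ _ _ _ _).2.1.
  by move: h => /= /and4P[-> -> ->].
- by move=> a b _; rewrite /H09_relation !(rowswap _ a a b d e f).2.2.
move=> a b c abc; move: d e f.
apply: (@sort3_ind (fun d e f => all (gtn 5) [:: a; b; c; d; e; f] ->
  H09_relation a b c d e f)).
- move=> d e f IH h; apply: rel_opp (IH _); try apply: (colswap _ _ _ _ _ _ _).1.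
  by move: h => /= /and5P[-> -> -> -> /and3P[-> ->]].
- move=> d e f IH h; apply: rel_opp (IH _); try apply: (colswap _ _ _ _ _ _ _).2.1.
  by move: h => /= /and5P[-> -> -> -> /and3P[-> ->]].
- by move=> d e _; rewrite /H09_relation !(colswap _ a b c d d e).2.2.
move=> d e f def /= /and5P[ha hb hc hd /and3P[he hf _]].
have in5 i : (i < 5)%N -> i \in iota 0 5 by rewrite mem_iota.
have := H09_relation_sorted.
move=> /allP/(_ a (in5 a ha)) /allP/(_ b (in5 b hb)) /allP/(_ c (in5 c hc)).
rewrite abc.
move=> /allP/(_ d (in5 d hd)) /allP/(_ e (in5 e he)) /allP/(_ f (in5 f hf)).
by rewrite def.
Qed.

Lemma det3_intr (F : nat -> nat -> int) a b c d e f :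
  (det3 F a b c d e f)%:~R = det3 (fun i j => (F i j)%:~R : C) a b c d e f.
Proof. by rewrite /det3 /det2 !(rmorphB, rmorphD, rmorphM). Qed.

(* For a pencil [x S + y K] with [S] symmetric invertible, [K] skew and
   [(S^-1 K)^2 = 0], the adjugate has no [x y^2] term; in terms of
   [M = S + K] this is a linear relation between three members of the pencil. *)
Lemma H09_minor_obstruction B a b c d e f :
  degenerates (struct_of (H09 1)) (struct_of B) ->
  all (gtn 5) [:: a; b; c; d; e; f] ->
  4 * det3 (pen (seq_of B) (1, 0)) a b c d e f
  + 4 * det3 (pen (seq_of B) (0, 1)) a b c d e f
  = det3 (pen (seq_of B) (1, 1)) a b c d e f.
Proof.
rewrite !struct_ofE !heisE => dg /= /and5P[ha hb hc hd /and3P[he hf _]].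
have : minor_relation 3 [:: (4, (1, 0)); (4, (0, 1)); (-1, (1, 1))] (form (seq_of (H09 1))).
  move=> u v; rewrite !big_cons big_nil /=.
  have detE p : \det (mxsub u v (pencil (form (seq_of (H09 1))) p)) =
      det3 (pen (seq_of (H09 1)) p) (u (inord 0)) (u (inord 1)) (u (inord 2))
                                    (v (inord 0)) (v (inord 1)) (v (inord 2)).
    transitivity (\det (\matrix_(i < 3, j < 3)
                    pen (seq_of (H09 1)) p (u (inord i)) (v (inord j)))).
      congr (\det _); apply/matrixP=> i j.
      by rewrite [LHS]mxE [RHS]mxE pencil_form !inord_val.
    exact: (det_matrix3 (fun i j => pen _ p (u (inord i)) (v (inord j)))).
  have entE i j : (i < 5)%N -> (j < 5)%N ->
      entry (seq_of (H09 1)) i j = (H09_int i j)%:~R.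
    by move: i j => [|[|[|[|[|?]]]]] [|[|[|[|[|?]]]]] // _ _; rewrite /= ?addr0.
  have ext F G : (forall i j, (i < 5)%N -> (j < 5)%N -> F i j = (G i j)%:~R :> C) ->
      forall (i j k l m n : 'I_5), det3 F i j k l m n = (det3 G i j k l m n)%:~R.
    by move=> h *; rewrite det3_intr /det3 /det2 !h.
  rewrite !detE.
  rewrite (ext _ H09_int); last by move=> i j hi hj; rewrite /pen mul1r mul0r addr0 entE.
  rewrite (ext _ (fun i j => H09_int j i)); last first.
    by move=> i j hi hj; rewrite /pen mul1r mul0r add0r entE.
  rewrite (ext _ (fun i j => H09_int i j + H09_int j i)); last first.
    by move=> i j hi hj; rewrite /pen !mul1r !entE // rmorphD.
  set u0 := u _; set u1 := u _; set u2 := u _.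
  set v0 := v _; set v1 := v _; set v2 := v _.
  have /eqP : H09_relation u0 u1 u2 v0 v1 v2.
    by apply: H09_relation_all; rewrite /= !ltn_ord.
  move/(congr1 (fun z : int => z%:~R : C)); rewrite rmorphD !rmorphM /= => <-.
  by ring.
move/(minor_relation_degenerates dg) => /(_ (fun i => inord (nth 0 [:: a; b; c]%N i))
  (fun i => inord (nth 0 [:: d; e; f]%N i))).
have detE p := det_matrix3 (fun i j =>
  pen (seq_of B) p (nth 0 [:: a; b; c]%N i) (nth 0 [:: d; e; f]%N j)).
rewrite !big_cons big_nil /= !minor_pen; try by case=> [|[|[|i]]].
rewrite !detE mulN1r addr0 addrA => /eqP; rewrite subr_eq0 => /eqP.
exact.
Qed.

(** * Special parameter values and asymmetric minors *)

Lemma neq_m1_1 : (-1 : C) <> 1.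
Proof.
move=> e; have : (2 : C) = 0 by rewrite -[2]/(1 + 1) -[X in X + _]e addNr.
by move/eqP; rewrite pnatr_eq0.
Qed.

Lemma neq_0_1 : (0 : C) <> 1.
Proof. by move/esym/eqP; rewrite oner_eq0. Qed.

Lemma neq_m1_0 : (-1 : C) <> 0.
Proof. by move/eqP; rewrite oppr_eq0 oner_eq0. Qed.

(** The hypotheses give [Re m <= -1], and this half plane meets the closed unit disc only in -1. So
    [-1] as first parameter of [H13] forces the second. *)
Lemma right_half_m1 (m : C) : in_unit_disc_half m -> in_right_half (-1 - m) ->
  m = -1.
Proof.
move=> hm hr; have m1 : `|m| <= 1 by case: hm => [/ltW|[->]].
have Re1 : 'Re (1 : C) = 1 by apply/Creal_ReP/rpred1.
have Rem : 'Re m <= -1.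
  have e : 'Re (-1 - m) = -1 - 'Re m by rewrite raddfB /= raddfN /= Re1.
  case: hr; rewrite e; first by rewrite subr_gt0 => /ltW.
  by case=> /eqP; rewrite subr_eq0 => /eqP <-.
have Im2 : 'Re m ^+ 2 + 'Im m ^+ 2 <= 1.
  by rewrite -normC2_Re_Im expr_le1.
have Im0 : 0 <= 'Im m ^+ 2 by rewrite -realEsqr Creal_Im.
have Re2 : 1 <= 'Re m ^+ 2.
  by rewrite -sqrrN exprn_ege1 // lerNr.
have Im2' : 'Im m ^+ 2 = 0.
  apply/eqP; rewrite eq_le Im0 andbT.
  by rewrite -(lerD2l ('Re m ^+ 2)) addr0 (le_trans Im2).
have Imm : 'Im m = 0 by apply/eqP; move/eqP: Im2'; rewrite sqrf_eq0.
have : 'Re m = -1.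
  have : 'Re m ^+ 2 = 1.
    by apply/eqP; rewrite eq_le Re2 andbT; move: Im2; rewrite Im2' addr0.
  move/eqP; rewrite sqrf_eq1 => /orP[] /eqP // e.
  by move: Rem; rewrite e (lt_geF (lt_trans (ltrN10 _) ltr01)).
by move=> Rem1; rewrite [m]Crect Imm Rem1 mulr0 addr0.
Qed.

(** By transposition the determinant of a pencil is symmetric in [x] and [y], and in a limit of a
    form on a plane every 2-minor would be proportional to it. The minor of [H06] used here is
    [x^2]. *)
Lemma H06_not_from_plane A : supported 2 (seq_of A) ->
  ~ degenerates (struct_of A) (struct_of H06).
Proof.
rewrite !struct_ofE => A2 dg.
have r5 i : (i < 2 -> nth 0 [:: 0; 1] i < 5)%N by case: i => [|[|i]].
have c5 i : (i < 2 -> nth 0 [:: 1; 2] i < 5)%N by case: i => [|[|i]].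
have detE p : \det (\matrix_(i < 2, j < 2) pen (seq_of H06) p
    (nth 0 [:: 0; 1]%N i) (nth 0 [:: 1; 2]%N j)) = p.1 ^+ 2.
  rewrite (det_matrix2 (fun i j => pen _ p (nth 0 [:: 0; 1]%N i) (nth 0 [:: 1; 2]%N j))).
  by rewrite /det2 /pen /=; ring.
have obs0 p := @det0_obstruction 2 _ _ p _ _ dg A2 isT r5 c5.
have obs p q := @det_obstruction 2 _ _ p q _ _ dg A2 isT r5 c5.
case eA : (cls2 A) => [l|]; last first.
  have := obs0 (1, 0); rewrite detE det_matrix2 det2_pen // eA /= expr1n => /(_ erefl).
  by move/eqP; rewrite oner_eq0.
have := obs (1, 0) (0, 1); have := obs (1, 0) (1, 1).
rewrite !detE !det_matrix2 !det2_pen // eA /quad /= => e1 e2.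
have l0 : l = 0.
  by transitivity (- (- ((0 + l * 1) * (1 + l * 0)) * 1 ^+ 2)); [ring | rewrite e2; ring].
move: e1; rewrite l0 => e1; have : (1 : C) = 0.
  by transitivity (- (- ((1 + 0 * 1) * (1 + 0 * 1)) * 1 ^+ 2) : C); [ring | rewrite e1; ring].
by move/eqP; rewrite oner_eq0.
Qed.

(** The same asymmetry in size 3, now with the minor [(x + y) x^2] of [H10]. *)
Lemma H10_not_from_space A : supported 3 (seq_of A) ->
  ~ degenerates (struct_of A) (struct_of H10).
Proof.
rewrite !struct_ofE => A3 dg.
have r5 i : (i < 3 -> nth 0 [:: 0; 1; 2] i < 5)%N by case: i => [|[|[|i]]].
have c5 i : (i < 3 -> nth 0 [:: 0; 2; 3] i < 5)%N by case: i => [|[|[|i]]].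
have detE p : \det (\matrix_(i < 3, j < 3) pen (seq_of H10) p
    (nth 0 [:: 0; 1; 2]%N i) (nth 0 [:: 0; 2; 3]%N j)) = (p.1 + p.2) * p.1 ^+ 2.
  rewrite (det_matrix3 (fun i j => pen _ p (nth 0 [:: 0; 1; 2]%N i) (nth 0 [:: 0; 2; 3]%N j))).
  by rewrite /det3 /det2 /pen /=; ring.
have obs0 p := @det0_obstruction 3 _ _ p _ _ dg A3 isT r5 c5.
have obs p q := @det_obstruction 3 _ _ p q _ _ dg A3 isT r5 c5.
have [c c0 detA] := det3_pen A3.
case eA : (cls3 A) => [l|]; last first.
  have := obs0 (1, 0); rewrite detE det_matrix3 detA // eA /= addr0 mul1r expr1n => /(_ erefl).
  by move/eqP; rewrite oner_eq0.
have := obs (1, 0) (0, 1); have := obs (1, 0) (1, 1).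
rewrite !detE !det_matrix3 !detA // eA /quad /= => e1 e2.
have l0 : c * l = 0.
  by transitivity (c * ((0 + 1) * ((0 + l * 1) * (1 + l * 0))) * ((1 + 0) * 1 ^+ 2)); [ring | rewrite e2; ring].
move/eqP: l0; rewrite mulf_eq0 (negPf c0) => /eqP l0.
move: e1; rewrite l0 => e1; have : c * 2 = 0.
  by transitivity (c * ((1 + 1) * ((1 + 0 * 1) * (1 + 0 * 1))) * ((1 + 0) * 1 ^+ 2)); [ring | rewrite e1; ring].
by move/eqP; rewrite mulf_eq0 (negPf c0) pnatr_eq0.
Qed.

(** * Paths in the graph *)

Lemma gamma_step A B D : admissible A -> admissible B -> gamma_edge A B ->
  gamma_path B D -> gamma_path A D.
Proof. by move=> aA aB e; apply: rt_trans; apply: rt_step. Qed.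

Lemma gamma_refl A : gamma_path A A.
Proof. exact: rt_refl. Qed.

Lemma neq_1_m1 : (1 : C) <> -1.
Proof. exact: nesym neq_m1_1. Qed.

Lemma neq_0_m1 : (0 : C) <> -1.
Proof. exact: nesym neq_m1_0. Qed.

#[local] Hint Resolve disc0 disc1 discN1 right_half_subrr gamma_refl neq_m1_1 neq_0_1
  neq_m1_0 : core.
#[local] Hint Resolve neq_1_m1 neq_0_m1 : core.

Ltac side := first [assumption | simpl; repeat split; auto].
Ltac via X := apply: (@gamma_step _ X);
  [side | side | side | try exact: gamma_refl].

Lemma path_03_C5 l : admissible (H03 l) -> gamma_path (H03 l) C5.
Proof.
move=> al; have [->|/eqP l1] := eqVneq l (-1); first by via C5.
by via H01; via C5.
Qed.

Lemma path_from_06 B : admissible B ->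
  match B with C5 | H01 | H02 | H03 _ | H06 => true | _ => false end ->
  gamma_path H06 B.
Proof.
case: B => [|||l||l||||l||||l m|l|] // aB _.
- by via H02; via H01; via C5.
- by via H02; via H01.
- by via H02.
- by via (H03 l).
Qed.

Lemma path_from_10 B : admissible B ->
  match B with
  | C5 | H01 | H02 | H03 _ | H04 | H05 _ | H06 | H07 | H10 => true
  | _ => false
  end -> gamma_path H10 B.
Proof.
case: B => [|||l||l||||l||||l m|l|] // aB _;
  try by via H04; via H06; apply: path_from_06.
- by via (H05 l).
- by via H07.
Qed.

(** * All degenerations of each algebra *)

Lemma eq0_of (x y : C) : x = 0 -> y = x -> y = 0.
Proof. by move=> ->. Qed.

Lemma eq0_ofN (x y : C) : x = 0 -> y = - x -> y = 0.
Proof. by move=> -> ->; rewrite oppr0. Qed.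

(** Here [k] is, up to sign, the value of the entry or minor that [h] makes zero: the numbers 1, 2,
    4, 8 and the factored expressions in the calls are such values. *)
Ltac vanish h k := have /eqP : k = 0 :> C by
  first [ apply: (eq0_of h); rewrite /det3 /det2 /pen /=; ring
        | apply: (eq0_ofN h); rewrite /det3 /det2 /pen /=; ring ].
Ltac absurd_num h k := exfalso; vanish h k; rewrite ?oner_eq0 ?pnatr_eq0.

Ltac absurd4 aA aB dg :=
  by have [? [? []]] := cls4_degenerates aA aB dg erefl.
Ltac absurd3 aA aB dg :=
  by have := cls3_degenerates aA aB dg isT isT erefl.
Ltac absurd2 aA aB dg :=
  by have := cls2_degenerates aA aB dg isT isT erefl.

Lemma gamma_path_of_C5 B : admissible B ->
  degenerates (struct_of C5) (struct_of B) -> gamma_path C5 B.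
Proof.
have obs := @C5_obstruction B (1, 0).
case: B obs => [|||l||l||||l||||l m|l|] obs aB dg //; try absurd4 (I : admissible C5) aB dg;
  try absurd3 (I : admissible C5) aB dg; try absurd2 (I : admissible C5) aB dg.
- by have h := obs 0%N 0%N dg isT isT; absurd_num h (1 : C).
- by have h := obs 0%N 1%N dg isT isT; absurd_num h (1 : C).
- by have h := obs 0%N 0%N dg isT isT; absurd_num h (1 : C).
Qed.

Lemma gamma_path_of_01 B : admissible B ->
  degenerates (struct_of H01) (struct_of B) -> gamma_path H01 B.
Proof.
case: B => [|||l||l||||l||||l m|l|] aB dg //;
  try absurd4 (I : admissible H01) aB dg;
  try absurd3 (I : admissible H01) aB dg;
  try absurd2 (I : admissible H01) aB dg.
- by via C5.
- by case: (@H06_not_from_plane H01 isT dg).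
- by case: (@H10_not_from_space H01 isT dg).
Qed.

Lemma gamma_path_of_02 B : admissible B ->
  degenerates (struct_of H02) (struct_of B) -> gamma_path H02 B.
Proof.
case: B => [|||l||l||||l||||l m|l|] aB dg //;
  try absurd4 (I : admissible H02) aB dg;
  try absurd3 (I : admissible H02) aB dg.
- by via H01; via C5.
- by via H01.
- have /Some_inj <- := cls2_degenerates (I : admissible H02) aB dg isT isT erefl.
  by via (H03 (-1)).
- by case: (@H06_not_from_plane H02 isT dg).
- by case: (@H10_not_from_space H02 isT dg).
Qed.

Lemma gamma_path_of_03 l B : admissible (H03 l) -> admissible B ->
  degenerates (struct_of (H03 l)) (struct_of B) -> gamma_path (H03 l) B.
Proof.
move=> aA; case: B => [|||n||n||||n||||n p|n|] aB dg //;
  try absurd4 aA aB dg; try absurd3 aA aB dg.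
- exact: path_03_C5.
- have [e|/eqP l1] := eqVneq l (-1); last by via H01.
  rewrite e in dg; have h := H03_skew_obstruction (i := 0) (j := 0) dg isT isT.
  by absurd_num h (2 : C).
- have /Some_inj e := cls2_degenerates aA aB dg isT isT erefl.
  rewrite e in dg; have h := H03_skew_obstruction (i := 1) (j := 1) dg isT isT.
  by absurd_num h (2 : C).
- by have /Some_inj -> := cls2_degenerates aA aB dg isT isT erefl.
- by case: (@H06_not_from_plane (H03 l) isT dg).
- by case: (@H10_not_from_space (H03 l) isT dg).
Qed.

Lemma gamma_path_of_04 B : admissible B ->
  degenerates (struct_of H04) (struct_of B) -> gamma_path H04 B.
Proof.
case: B => [|||l||l||||l||||l m|l|] aB dg //;
  try absurd4 (I : admissible H04) aB dg;
  try by via H06; apply: path_from_06.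
- have /Some_inj <- := cls3_degenerates (I : admissible H04) aB dg isT isT erefl.
  by via (H05 (-1)).
- by have /Some_inj e
    := cls3_degenerates (I : admissible H04) aB dg isT isT erefl;
  case: (neq_m1_1 e).
- by case: (@H10_not_from_space H04 isT dg).
Qed.

Lemma gamma_path_of_05_1 B : admissible B ->
  degenerates (struct_of (H05 1)) (struct_of B) -> gamma_path (H05 1) B.
Proof.
have aA : admissible (H05 1) by exact: disc1.
have obs := @H05_sym_obstruction B.
case: B obs => [|||n||n||||n||||n p|n|] obs aB dg //; try absurd4 aA aB dg.
- by via (H03 1); via H01; via C5.
- by via (H03 1); via H01.
- by have h := obs 0 1 dg isT isT; absurd_num h (2 : C).
- have h := obs 0 1 dg isT isT; vanish h (1 - n).
  by rewrite subr_eq0 => /eqP <-; via (H03 1).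
- by have /Some_inj e
    := cls3_degenerates aA aB dg isT isT erefl;
  case: (neq_1_m1 e).
- by have /Some_inj -> := cls3_degenerates aA aB dg isT isT erefl.
- by have h := obs 0 1 dg isT isT; absurd_num h (1 : C).
- by have h := obs 1 2 dg isT isT; absurd_num h (2 : C).
- by case: (@H10_not_from_space (H05 1) isT dg).
Qed.

Lemma gamma_path_of_05_m1 B : admissible B ->
  degenerates (struct_of (H05 (-1))) (struct_of B) -> gamma_path (H05 (-1)) B.
Proof.
have aA : admissible (H05 (-1)) by exact: discN1.
have obs := @H05_symrank_obstruction B.
case: B obs => [|||n||n||||n||||n p|n|] obs aB dg //; try absurd4 aA aB dg.
- by via H02; via H01; via C5.
- by via H02; via H01.
- by via H02.
- have h := obs 0 1 0 1 dg isT; vanish h ((n + 1) ^+ 2).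
  by rewrite sqrf_eq0 addr_eq0 => /eqP ->; via H02; via (H03 (-1)).
- by have h := obs 0 2 0 2 dg isT; absurd_num h (4 : C).
- by have /Some_inj -> := cls3_degenerates aA aB dg isT isT erefl.
- by have h := obs 0 1 0 1 dg isT; absurd_num h (1 : C).
- by have /Some_inj e
    := cls3_degenerates aA aB dg isT isT erefl;
  case: (neq_m1_1 e).
- by case: (@H10_not_from_space (H05 (-1)) isT dg).
Qed.

Lemma gamma_path_of_05 l B : admissible (H05 l) -> admissible B ->
  degenerates (struct_of (H05 l)) (struct_of B) -> gamma_path (H05 l) B.
Proof.
have [->|/eqP l1] := eqVneq l 1; first by move=> _; apply: gamma_path_of_05_1.
have [->|/eqP l2] := eqVneq l (-1); first by move=> _; apply: gamma_path_of_05_m1.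
move=> aA; case: B => [|||n||n||||n||||n p|n|] aB dg //; try absurd4 aA aB dg;
  try by via H06; apply: path_from_06.
- by have /Some_inj e
    := cls3_degenerates aA aB dg isT isT erefl;
  case: (l2 e).
- by have /Some_inj -> := cls3_degenerates aA aB dg isT isT erefl.
- by have /Some_inj e
    := cls3_degenerates aA aB dg isT isT erefl;
  case: (l1 e).
- by case: (@H10_not_from_space (H05 l) isT dg).
Qed.

Lemma gamma_path_of_06 B : admissible B ->
  degenerates (struct_of H06) (struct_of B) -> gamma_path H06 B.
Proof.
case: B => [|||l||l||||l||||l m|l|] aB dg //;
  try absurd4 (I : admissible H06) aB dg;
  try absurd3 (I : admissible H06) aB dg;
  try exact: path_from_06.
by case: (@H10_not_from_space H06 isT dg).
Qed.

Lemma gamma_path_of_07 B : admissible B ->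
  degenerates (struct_of H07) (struct_of B) -> gamma_path H07 B.
Proof.
case: B => [|||l||l||||l||||l m|l|] aB dg //;
  try absurd4 (I : admissible H07) aB dg;
  try by via H06; apply: path_from_06.
- by have /Some_inj e
    := cls3_degenerates (I : admissible H07) aB dg isT isT erefl;
  case: (neq_1_m1 e).
- have /Some_inj <- := cls3_degenerates (I : admissible H07) aB dg isT isT erefl.
  by via (H05 1).
- by case: (@H10_not_from_space H07 isT dg).
Qed.

Lemma gamma_path_of_08 B : admissible B ->
  degenerates (struct_of H08) (struct_of B) -> gamma_path H08 B.
Proof.
case: B => [|||l||l||||l||||l m|l|] aB dg //;
  try by via H10; apply: path_from_10.
- have [? [? [[<- <-] _ _ h _]]] := cls4_degenerates (I : admissible H08) aB dg erefl.
  by case: aB => _ [h0 _]; case: h => e; case: (h0 e).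
- by have [? [? [[<- <-] [e|e] _ _ _]]]
    := cls4_degenerates (I : admissible H08) aB dg erefl;
  case: (neq_m1_1 e).
- by via H12.
- have [? [? [[<- <-] _ _ [->|->] [->|->]]]] := cls4_degenerates (I : admissible H08) aB dg erefl;
  by via H12; via (H14 (-1)); via (H13 (-1) (-1)).
- have [? [? [[<- <-] _ _ [->|->] _]]] := cls4_degenerates (I : admissible H08) aB dg erefl;
  by via H12; via (H14 (-1)).
- by have [? [? [[<- <-] [e|e] _ _ _]]]
    := cls4_degenerates (I : admissible H08) aB dg erefl;
  case: (neq_m1_0 e).
Qed.

Lemma gamma_path_of_09_1 B : admissible B ->
  degenerates (struct_of (H09 1)) (struct_of B) -> gamma_path (H09 1) B.
Proof.
have aA : admissible (H09 1) by side.
have obs := @H09_minor_obstruction B.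
have {}obs a b c d e f : degenerates (struct_of (H09 1)) (struct_of B) ->
    all (gtn 5) [:: a; b; c; d; e; f] ->
    4 * det3 (pen (seq_of B) (1, 0)) a b c d e f
    + 4 * det3 (pen (seq_of B) (0, 1)) a b c d e f
    - det3 (pen (seq_of B) (1, 1)) a b c d e f = 0.
  by move=> dg h; rewrite obs // subrr.
case: B obs => [|||n||n||||n||||n p|n|] obs aB dg //;
  try by via H07; via H06; apply: path_from_06.
- by have h := obs 0 1 2 0 1 2 dg isT; absurd_num h (8 : C).
- have h := obs 0 1 2 0 1 2 dg isT; vanish h (2 * (n - 1) ^+ 2).
  rewrite mulf_eq0 pnatr_eq0 sqrf_eq0 subr_eq0 => /eqP->.
  by via H07; via (H05 1).
- have [? [? [[<- <-] [e|e] _ _ _]]] := cls4_degenerates aA aB dg erefl;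
  by case: neq_1_m1.
- by have [? [? [[<- <-] _ _ [->|->] _]]] := cls4_degenerates aA aB dg erefl.
- by have h := obs 0 1 2 0 1 2 dg isT; absurd_num h (2 : C).
- by have h := obs 0 2 3 0 2 3 dg isT; absurd_num h (8 : C).
- have [? [? [[<- <-] [e|e] _ _ _]]] := cls4_degenerates aA aB dg erefl;
  by case: neq_1_m1.
- have [? [? [[<- <-] _ _ [->|->] [->|->]]]] := cls4_degenerates aA aB dg erefl;
  by via (H13 1 1).
- have [? [? [[<- <-] _ _ _ [e|e]]]] := cls4_degenerates aA aB dg erefl;
  by case: neq_m1_1.
- have [? [? [[<- <-] [e|e] _ _ _]]] := cls4_degenerates aA aB dg erefl;
  by case: neq_0_1.
Qed.

Lemma gamma_path_of_09 l B : admissible (H09 l) -> admissible B ->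
  degenerates (struct_of (H09 l)) (struct_of B) -> gamma_path (H09 l) B.
Proof.
have [->|/eqP l1] := eqVneq l 1; first by move=> _; apply: gamma_path_of_09_1.
move=> aA; have [dl [lm1 l0]] := aA.
case: B => [|||n||n||||n||||n p|n|] aB dg //;
  try by via H10; apply: path_from_10.
- by have [? [? [[<- <-] [e|e] _ _ _]]]
    := cls4_degenerates aA aB dg erefl;
  case: (lm1 e).
- by have [? [? [[<- <-] _ _ [->|->] _]]] := cls4_degenerates aA aB dg erefl.
- by have [? [? [[<- <-] [e|e] _ _ _]]]
    := cls4_degenerates aA aB dg erefl;
  case: (l1 e).
- by have [? [? [[<- <-] [e|e] _ _ _]]]
    := cls4_degenerates aA aB dg erefl;
  case: (lm1 e).
- have [? [? [[<- <-] _ _ [->|->] [->|->]]]] := cls4_degenerates aA aB dg erefl;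
  by via (H13 l l).
- have [? [? [[<- <-] _ _ _ [e|e]]]] := cls4_degenerates aA aB dg erefl;
  by case: lm1.
- by have [? [? [[<- <-] [e|e] _ _ _]]]
    := cls4_degenerates aA aB dg erefl;
  case: (l0 e).
Qed.

Lemma gamma_path_of_10 B : admissible B ->
  degenerates (struct_of H10) (struct_of B) -> gamma_path H10 B.
Proof.
case: B => [|||l||l||||l||||l m|l|] aB dg //;
  try absurd4 (I : admissible H10) aB dg; exact: path_from_10.
Qed.

Lemma gamma_path_of_11 B : admissible B ->
  degenerates (struct_of H11) (struct_of B) -> gamma_path H11 B.
Proof.
have aA : admissible H11 by [].
case: B => [|||n||n||||n||||n p|n|] aB dg //;
  try by via H10; apply: path_from_10.
- have [? [? [[<- <-] [e|e] _ _ _]]] := cls4_degenerates aA aB dg erefl;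
  by case: neq_1_m1.
- have [? [? [[<- <-] _ _ [->|->] _]]] := cls4_degenerates aA aB dg erefl;
  by via (H09 1).
- have [? [? [[<- <-] [e|e] _ _ _]]] := cls4_degenerates aA aB dg erefl;
  by case: neq_1_m1.
- have [? [? [[<- <-] _ _ [->|->] [->|->]]]] := cls4_degenerates aA aB dg erefl;
  by via (H09 1); via (H13 1 1).
- have [? [? [[<- <-] _ _ _ [e|e]]]] := cls4_degenerates aA aB dg erefl;
  by case: neq_m1_1.
- have [? [? [[<- <-] [e|e] _ _ _]]] := cls4_degenerates aA aB dg erefl;
  by case: neq_0_1.
Qed.

Lemma gamma_path_of_12 B : admissible B ->
  degenerates (struct_of H12) (struct_of B) -> gamma_path H12 B.
Proof.
have aA : admissible H12 by [].
have obs := @H12_symrank_obstruction B.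
case: B obs => [|||n||n||||n||||n p|n|] obs aB dg //;
  try by via H04; via H06; apply: path_from_06.
- have h := obs 0 1 2 0 1 2 dg isT; vanish h (2 * (n + 1) ^+ 2).
  rewrite mulf_eq0 pnatr_eq0 sqrf_eq0 addr_eq0 => /eqP->.
  by via H04; via (H05 (-1)).
- by have h := obs 0 1 2 0 1 2 dg isT; absurd_num h (8 : C).
- by have h := obs 1 2 3 1 2 3 dg isT; absurd_num h (8 : C).
- have [? [? [[<- <-] _ _ h _]]] := cls4_degenerates aA aB dg erefl.
  by case: aB => _ [h0 _]; case: h => e; case: (h0 e).
- by have h := obs 0 1 2 0 1 2 dg isT; absurd_num h (2 : C).
- have [? [? [[<- <-] [e|e] _ _ _]]] := cls4_degenerates aA aB dg erefl;
  by case: neq_m1_1.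
- have [? [? [[<- <-] _ _ [->|->] [->|->]]]] := cls4_degenerates aA aB dg erefl;
  by via (H14 (-1)); via (H13 (-1) (-1)).
- have [? [? [[<- <-] _ _ [->|->] _]]] := cls4_degenerates aA aB dg erefl;
  by via (H14 (-1)).
- have [? [? [[<- <-] [e|e] _ _ _]]] := cls4_degenerates aA aB dg erefl;
  by case: neq_m1_0.
Qed.

(** The determinant does not exclude [H08] and [H12]; the rank of [M + M^T], which is one here,
    does. *)
Lemma gamma_path_of_14_m1 B : admissible B ->
  degenerates (struct_of (H14 (-1))) (struct_of B) -> gamma_path (H14 (-1)) B.
Proof.
have aA : admissible (H14 (-1)) by side.
have obs := @H14_symrank_obstruction B.
case: B obs => [|||n||n||||n||||n p|n|] obs aB dg //.
- by via (H05 (-1)); via H02; via H01; via C5.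
- by via (H05 (-1)); via H02; via H01.
- by via (H05 (-1)); via H02.
- have h := obs 0 1 0 1 dg isT; vanish h ((n + 1) ^+ 2).
  rewrite sqrf_eq0 addr_eq0 => /eqP ->.
  by via (H05 (-1)); via H02; via (H03 (-1)).
- by have h := obs 0 2 0 2 dg isT; absurd_num h (4 : C).
- have h := obs 1 2 1 2 dg isT; vanish h ((n + 1) ^+ 2).
  by rewrite sqrf_eq0 addr_eq0 => /eqP ->; via (H05 (-1)).
- by have h := obs 0 1 0 1 dg isT; absurd_num h (1 : C).
- by have h := obs 0 2 0 2 dg isT; absurd_num h (4 : C).
- by have h := obs 1 3 1 3 dg isT; absurd_num h (4 : C).
- have [? [? [[<- <-] _ _ h _]]] := cls4_degenerates aA aB dg erefl.
  by case: aB => _ [h0 _]; case: h => e; case: (h0 e).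
- by have h := obs 1 2 1 2 dg isT; absurd_num h (1 : C).
- have [? [? [[<- <-] [e|e] _ _ _]]] := cls4_degenerates aA aB dg erefl;
  by case: neq_m1_1.
- by have h := obs 1 3 1 3 dg isT; absurd_num h (4 : C).
- have [? [? [[<- <-] _ _ [->|->] [->|->]]]] := cls4_degenerates aA aB dg erefl;
  by via (H13 (-1) (-1)).
- by have [? [? [[<- <-] _ _ [->|->] _]]] := cls4_degenerates aA aB dg erefl.
- have [? [? [[<- <-] [e|e] _ _ _]]] := cls4_degenerates aA aB dg erefl;
  by case: neq_m1_0.
Qed.

Lemma gamma_path_of_14 l B : admissible (H14 l) -> admissible B ->
  degenerates (struct_of (H14 l)) (struct_of B) -> gamma_path (H14 l) B.
Proof.
have [->|/eqP l1] := eqVneq l (-1); first by move=> _; apply: gamma_path_of_14_m1.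
move=> aA; case: B => [|||n||n||||n||||n p|n|] aB dg //;
  try by via H10; apply: path_from_10.
- by have [? [? [[<- <-] [e|e] _ _ _]]]
    := cls4_degenerates aA aB dg erefl;
  case: (l1 e).
- have [? [? [[<- <-] _ h _ _]]] := cls4_degenerates aA aB dg erefl.
  by case: aB => _ [h0 _]; case: h => e; case: h0.
- have [? [? [[<- <-] _ [e|e] _ _]]] := cls4_degenerates aA aB dg erefl;
  by case: neq_m1_1.
- by have [? [? [[<- <-] [e|e] _ _ _]]]
    := cls4_degenerates aA aB dg erefl;
  case: (l1 e).
- have [? [? [[<- <-] hl hm hn hp]]] := cls4_degenerates aA aB dg erefl.
  (* The pair [n, p] equals [l, -1] up to order. With [n = -1], admissibility would give [p = -1]
     and then [l = -1]. *)
  have [n1|/eqP n1] := eqVneq n (-1).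
    case: aB => _ [dp hr]; rewrite n1 in hr.
    have p1 := right_half_m1 dp hr.
    by case: hl => e; case: l1; rewrite e.
  have nl : n = l by case: hn.
  have p1 : p = -1 by case: hm => // e; case: n1.
  rewrite nl p1 in aB *; apply: (@gamma_step _ (H13 l (-1))) => //; right.
  by [].
- have [? [? [[<- <-] [->|e] _ _ _]]] := cls4_degenerates aA aB dg erefl => //.
- have [? [? [[<- <-] _ [e|e] _ _]]] := cls4_degenerates aA aB dg erefl;
  by case: neq_m1_0.
Qed.

Lemma gamma_path_of_15 B : admissible B ->
  degenerates (struct_of H15) (struct_of B) -> gamma_path H15 B.
Proof.
have aA : admissible H15 by [].
case: B => [|||n||n||||n||||n p|n|] aB dg //;
  try by via H10; apply: path_from_10.
- have [? [? [[<- <-] [e|e] _ _ _]]] := cls4_degenerates aA aB dg erefl;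
  by case: neq_0_m1.
- have [? [? [[<- <-] _ _ h _]]] := cls4_degenerates aA aB dg erefl.
  by case: aB => _ [_ h0]; case: h => e; case: (h0 e).
- have [? [? [[<- <-] [e|e] _ _ _]]] := cls4_degenerates aA aB dg erefl;
  by case: neq_0_1.
- have [? [? [[<- <-] [e|e] _ _ _]]] := cls4_degenerates aA aB dg erefl;
  by case: neq_0_m1.
- have [? [? [[<- <-] _ _ [->|->] [->|->]]]] := cls4_degenerates aA aB dg erefl;
  by via (H13 0 0).
- have [? [? [[<- <-] _ _ _ [e|e]]]] := cls4_degenerates aA aB dg erefl;
  by case: neq_m1_0.
Qed.

(** The determinant gives the parameters up to order; the exchanged order contradicts
    [right_half_anti] unless they coincide. *)
Lemma H13_cls l m n p : admissible (H13 l m) -> admissible (H13 n p) ->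
  degenerates (struct_of (H13 l m)) (struct_of (H13 n p)) -> n = l /\ p = m.
Proof.
move=> aA aB dg.
have [? [? [[<- <-] hl hm hn hp]]] := cls4_degenerates aA aB dg erefl.
case: aA aB => _ [_ h1] [_ [_ h2]].
have [e|/eqP ln] := eqVneq l n.
  by split=> //; case: hp hm => // -> [] // ->.
have lp : l = p by case: hl.
case: hm => [mn|mp]; last by case: hn => e; case: ln; rewrite e // lp.
rewrite -mn -lp -opprB in h2; have := right_half_anti h1 h2.
by move/eqP; rewrite subr_eq0 => /eqP e; case: ln; rewrite e.
Qed.

Lemma gamma_path_of_13_m1 B : admissible B ->
  degenerates (struct_of (H13 (-1) (-1))) (struct_of B) ->
  gamma_path (H13 (-1) (-1)) B.
Proof.
have aA : admissible (H13 (-1) (-1)) by side.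
have obs := @H13_skew_obstruction B.
case: B obs => [|||n||n||||n||||n p|n|] obs aB dg //.
- by via (H03 (-1)); via C5.
- by have h := obs 0%N 0%N dg isT isT; absurd_num h (2 : C).
- by have h := obs 1%N 1%N dg isT isT; absurd_num h (2 : C).
- have h := obs 0%N 1%N dg isT isT; vanish h (n + 1).
  by rewrite addr_eq0 => /eqP ->; via (H03 (-1)).
- by have h := obs 0%N 0%N dg isT isT; absurd_num h (2 : C).
- by have h := obs 0%N 0%N dg isT isT; absurd_num h (2 : C).
- by have h := obs 0%N 1%N dg isT isT; absurd_num h (1 : C).
- by have h := obs 1%N 1%N dg isT isT; absurd_num h (2 : C).
- by have h := obs 1%N 3%N dg isT isT; absurd_num h (2 : C).
- have [? [? [[<- <-] _ _ h _]]] := cls4_degenerates aA aB dg erefl.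
  by case: aB => _ [h0 _]; case: h => e; case: (h0 e).
- by have h := obs 0%N 0%N dg isT isT; absurd_num h (2 : C).
- by have h := obs 0%N 0%N dg isT isT; absurd_num h (2 : C).
- by have h := obs 1%N 1%N dg isT isT; absurd_num h (2 : C).
- by have [-> ->] := H13_cls aA aB dg.
- by have h := obs 3%N 3%N dg isT isT; absurd_num h (2 : C).
- by have h := obs 0%N 1%N dg isT isT; absurd_num h (1 : C).
Qed.

Lemma gamma_path_of_13_1 B : admissible B ->
  degenerates (struct_of (H13 1 1)) (struct_of B) -> gamma_path (H13 1 1) B.
Proof.
have aA : admissible (H13 1 1) by side.
have obs := @H13_sym_obstruction B.
case: B obs => [|||n||n||||n||||n p|n|] obs aB dg //.
- by via (H05 1); via (H03 1); via H01; via C5.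
- by via (H05 1); via (H03 1); via H01.
- by have h := obs 0%N 1%N dg isT isT; absurd_num h (2 : C).
- have h := obs 0%N 1%N dg isT isT; vanish h (1 - n).
  by rewrite subr_eq0 => /eqP <-; via (H05 1); via (H03 1).
- by have h := obs 1%N 2%N dg isT isT; absurd_num h (2 : C).
- have h := obs 1%N 2%N dg isT isT; vanish h (1 - n).
  by rewrite subr_eq0 => /eqP <-; via (H05 1).
- by have h := obs 0%N 1%N dg isT isT; absurd_num h (1 : C).
- by have h := obs 1%N 2%N dg isT isT; absurd_num h (2 : C).
- by have h := obs 0%N 3%N dg isT isT; absurd_num h (2 : C).
- by have h := obs 1%N 2%N dg isT isT; absurd_num h (1 : C).
- by have h := obs 1%N 2%N dg isT isT; absurd_num h (1 : C).
- by have h := obs 2%N 3%N dg isT isT; absurd_num h (2 : C).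
- by have h := obs 0%N 1%N dg isT isT; absurd_num h (2 : C).
- by have [-> ->] := H13_cls aA aB dg.
- by have h := obs 2%N 3%N dg isT isT; absurd_num h (2 : C).
- by have h := obs 0%N 1%N dg isT isT; absurd_num h (1 : C).
Qed.

Lemma gamma_path_of_13_diag l B : l <> 1 -> l <> -1 -> admissible (H13 l l) ->
  admissible B -> degenerates (struct_of (H13 l l)) (struct_of B) ->
  gamma_path (H13 l l) B.
Proof.
move=> l1 lm1 aA; have dl := aA.1.
have obs := @H13_eigen_obstruction l B.
have l1' : l - 1 != 0 by rewrite subr_eq0; apply/eqP.
have l2' : l + 1 != 0 by rewrite addr_eq0; apply/eqP.
case: B obs => [|||n||n||||n||||n p|n|] obs aB dg //;
  try by via (H05 l); via H06; apply: path_from_06.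
- have h := obs 0 1 2 0 1 2 dg isT; vanish h ((l - 1) * (l + 1) ^+ 2).
  by rewrite mulf_eq0 sqrf_eq0 (negPf l1') (negPf l2').
- have h := obs 0 1 2 0 1 2 dg isT; vanish h ((l - 1) * ((l + n * -1) * (-1 + n * l))).
  rewrite mulf_eq0 (negPf l1') => /eqP q0.
  by rewrite -(quad_root dl aB q0); via (H05 l).
- have h := obs 0 1 2 0 1 2 dg isT; vanish h ((l - 1) ^+ 3).
  by rewrite expf_eq0 (negPf l1').
- have [? [? [[<- <-] [e|e] _ _ _]]] := cls4_degenerates aA aB dg erefl;
  by case: lm1.
(* In [H09 l] the two blocks are coupled, so the member at [(l, -1)] still has a nonzero 3-minor. *)
- have [? [? [[<- <-] [e|e] _ _ _]]] := cls4_degenerates aA aB dg erefl;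
  rewrite -e in obs dg; have h := obs 1 2 3 0 1 2 dg isT;
  vanish h (((l - 1) * (l + 1)) ^+ 2);
  by rewrite sqrf_eq0 mulf_eq0 (negPf l1') (negPf l2').
- have h := obs 0 2 3 0 1 2 dg isT; vanish h (l - 1).
  by rewrite (negPf l1').
- have [? [? [[<- <-] [e|e] _ _ _]]] := cls4_degenerates aA aB dg erefl;
  by case: l1.
- have [? [? [[<- <-] [e|e] _ _ _]]] := cls4_degenerates aA aB dg erefl;
  by case: lm1.
- by have [-> ->] := H13_cls aA aB dg.
- have [? [? [[<- <-] _ _ _ [e|e]]]] := cls4_degenerates aA aB dg erefl;
  by case: lm1.
- by have h := obs 1 2 3 0 1 2 dg isT; absurd_num h (1 : C).
Qed.

Lemma gamma_path_of_13_skew l B : l <> -1 -> admissible (H13 l (-1)) -> admissible B ->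
  degenerates (struct_of (H13 l (-1))) (struct_of B) ->
  gamma_path (H13 l (-1)) B.
Proof.
move=> l1 aA; have obs := @H13_symrank_obstruction l B.
case: B obs => [|||n||n||||n||||n p|n|] obs aB dg //;
  try by via H04; via H06; apply: path_from_06.
- have h := obs 0 1 2 0 1 2 dg isT; vanish h (2 * (n + 1) ^+ 2).
  rewrite mulf_eq0 pnatr_eq0 sqrf_eq0 addr_eq0 => /eqP->.
  by via H04; via (H05 (-1)).
- by have h := obs 0 1 2 0 1 2 dg isT; absurd_num h (8 : C).
- by have h := obs 1 2 3 1 2 3 dg isT; absurd_num h (8 : C).
- have [? [? [[<- <-] _ [e|e] _ _]]] := cls4_degenerates aA aB dg erefl;
  by case: aB => _ [h0 _]; case: h0.
- by have h := obs 0 1 2 0 1 2 dg isT; absurd_num h (2 : C).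
- have [? [? [[<- <-] _ [e|e] _ _]]] := cls4_degenerates aA aB dg erefl;
  by case: neq_m1_1.
- have [? [? [[<- <-] [e|e] _ _ _]]] := cls4_degenerates aA aB dg erefl;
  by case: l1.
- by have [-> ->] := H13_cls aA aB dg.
- have [? [? [[<- <-] [e|e] _ _ _]]] := cls4_degenerates aA aB dg erefl;
  last by case: l1.
  have h := obs 0 1 3 0 1 3 dg isT; vanish h (2 * (n + 1) ^+ 2).
  by rewrite mulf_eq0 pnatr_eq0 sqrf_eq0 addr_eq0 -e => /eqP /l1.
- have [? [? [[<- <-] _ [e|e] _ _]]] := cls4_degenerates aA aB dg erefl;
  by case: neq_m1_0.
Qed.

Lemma gamma_path_of_13 l m B : admissible (H13 l m) -> admissible B ->
  degenerates (struct_of (H13 l m)) (struct_of B) -> gamma_path (H13 l m) B.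
Proof.
move=> aA; have [dl [dm hr]] := aA.
(* The edge to [H10] is missing exactly for [l = -1], [m = l] or [m = -1]; these cases are treated
   apart, and [l = m = 1] once more, because the form is then symmetric. *)
have [e|/eqP l1] := eqVneq l (-1).
  rewrite e in hr aA *; rewrite (right_half_m1 dm hr).
  exact: gamma_path_of_13_m1.
have [e|/eqP lm] := eqVneq m l.
  rewrite e in aA *; have [e1|/eqP l2] := eqVneq l 1.
    by rewrite e1; exact: gamma_path_of_13_1.
  exact: gamma_path_of_13_diag.
have [e|/eqP m1] := eqVneq m (-1).
  by rewrite e in aA *; exact: gamma_path_of_13_skew.
case: B => [|||n||n||||n||||n p|n|] aB dg //;
  try by via H10; apply: path_from_10.
- have [? [? [[<- <-] [e|e] _ _ _]]] := cls4_degenerates aA aB dg erefl;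
  by case: l1.
- have [? [? [[<- <-] [e|e] [e'|e'] _ _]]] := cls4_degenerates aA aB dg erefl;
  by case: lm; rewrite e e'.
- have [? [? [[<- <-] [e|e] [e'|e'] _ _]]] := cls4_degenerates aA aB dg erefl;
  by case: lm; rewrite e e'.
- have [? [? [[<- <-] [e|e] _ _ _]]] := cls4_degenerates aA aB dg erefl;
  by case: l1.
- by have [-> ->] := H13_cls aA aB dg.
- have [? [? [[<- <-] _ _ _ [e|e]]]] := cls4_degenerates aA aB dg erefl;
  by [case: l1 | case: m1].
- have [? [? [[<- <-] [e|e] [e'|e'] _ _]]] := cls4_degenerates aA aB dg erefl;
  by case: lm; rewrite e e'.
Qed.

Theorem mainTheorem2 (A B : alg5) :
  admissible A -> admissible B ->
  (degenerates (struct_of A) (struct_of B) <-> gamma_path A B).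
Proof.
move=> aA aB; split; last exact: gamma_path_degenerates.
case: A aA => [|||l||l||||l||||l m|l|] aA.
- exact: gamma_path_of_C5.
- exact: gamma_path_of_01.
- exact: gamma_path_of_02.
- exact: gamma_path_of_03.
- exact: gamma_path_of_04.
- exact: gamma_path_of_05.
- exact: gamma_path_of_06.
- exact: gamma_path_of_07.
- exact: gamma_path_of_08.
- exact: gamma_path_of_09.
- exact: gamma_path_of_10.
- exact: gamma_path_of_11.
- exact: gamma_path_of_12.
- exact: gamma_path_of_13.
- exact: gamma_path_of_14.
- exact: gamma_path_of_15.
Qed.
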